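(* Let $T>0$ and $w>0$, and let the intertemporal aggregator $f:[0,T]\times\mathbb{R}_+\times\mathbb{R}\to\mathbb{R}$ satisfy the assumptions (a1)–(a3) listed in the context. Then for each $C\in\mathcal{A}(w)$ there exists a unique solution $U^C=(U^C_t)_{t\in[0,T]}$ of the equation $$U_t^C=\int_t^T f(s,Y_s^C,U_s^C)\,ds,\qquad t\in[0,T].$$ Moreover: (1) There is a constant $K>0$ such that for all $C,C'\in\mathcal{A}(w)$ and all $s\in[0,T]$, $$|U^C_s-U^{C'}_s|\leq \int_s^T e^{Kt}\,\bigl|f(t,Y_t^C,U_t^C)-f(t,Y_t^{C'},U_t^C)\bigr|\,dt,$$ and the utility functional $U:\mathcal{X}\to\mathbb{R}$, $C\mapsto U^C_0$, is continuous (with respect to the weak topology on $\mathcal{X}$). (2) The utility functional $C\mapsto U_0^C$ is strictly concave.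
   Context: Notation: $\mathbb{R}_+=[0,\infty)$, $\mathbb{R}_{++}=(0,\infty)$. $\mathcal{X}$ is the set of nondecreasing, right-continuous functions $C:[0,T]\to\mathbb{R}_+$, with the convention $C_{0-}:=0$; each $C\in\mathcal{X}$ is identified with the finite measure $dC$ on $[0,T]$ of which it is the distribution function (so $C_0>0$ is a point mass at $0$). Integrals with respect to $dC$ are over closed intervals. $\mathcal{X}$ carries the topology of weak convergence of finite measures on $[0,T]$. Price: $\psi:[0,T]\to\mathbb{R}_{++}$ is continuous, and $\mathcal{A}(w)=\{C\in\mathcal{X}:\int_0^T\psi_t\,dC_t\le w\}$ is the budget set. Level of satisfaction: $Y^C_t=\eta_t+\int_0^t\theta_{t,s}\,dC_s$, where $\eta:[0,T]\to\mathbb{R}_+$ and $\theta:[0,T]^2\to\mathbb{R}_+$ are continuous. Assumptions on $f$ ($f$ is Borel measurable in $s$): (a1) for each $s\in[0,T]$, $f(s,\cdot,\cdot)$ is strictly concave and continuously differentiable, and for all $s\in[0,T]$, $u\in\mathbb{R}$, $f(s,\cdot,u)$ is strictly increasing; (a2) there is a constant $K>0$ such that $|f(s,y,u)-f(s,y,u')|\le K|u-u'|$ for all $(s,y)\in[0,T]\times\mathbb{R}_+$ and $u,u'\in\mathbb{R}$; (a3) there are constants $\alpha\in(0,1)$ and $K>0$ such that $|f(s,y,0)|\le K(1+|y|^\alpha)$ for all $s\in[0,T]$, $y\in\mathbb{R}_+$.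
   Formalization: In (2), concavity is proved for all plans, but the strict inequality only when Y^C and Y^{C'} differ somewhere on [0,T); for distinct plans in general it fails, e.g. C=0 and C' a point mass at T give the same utility as all their mixtures. *)

(* Defs.v *)
From HB Require Import structures.
From mathcomp Require Import all_boot all_order all_algebra.
From mathcomp Require Import interval_inference.
From mathcomp Require Import all_classical all_reals all_analysis.

Set Implicit Arguments.
Unset Strict Implicit.
Unset Printing Implicit Defensive.

Import Order.TTheory GRing.Theory Num.Theory.
Import numFieldNormedType.Exports.

Local Open Scope classical_set_scope.
Local Open Scope ring_scope.

(** A nondecreasing right-continuous [C : [0,T] -> R_+] is encoded as its unique
    extension to the real line that is 0 on ]-oo,0[ (the convention
    [C_{0-} = 0]) and constant on [T,+oo[, that is, as the distribution function
    of the finite measure [dC] on [0,T].  Nonnegativity follows from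
    monotonicity. *)
Record plan (R : realType) (T : R) := Plan {
  plan_fun :> R -> R ;
  plan_nondecreasing : nondecreasing plan_fun ;
  plan_right_continuous : right_continuous plan_fun ;
  plan_lt0 : forall t, t < 0 -> plan_fun t = 0 ;
  plan_geT : forall t, T <= t -> plan_fun t = plan_fun T }.

HB.instance Definition _ (R : realType) (T : R) (C : plan T) :=
  isCumulative.Build R _ R (plan_fun C)
    (@plan_nondecreasing R T C) (@plan_right_continuous R T C).

HB.instance Definition _ (R : realType) (T : R) := gen_eqMixin (plan T).
HB.instance Definition _ (R : realType) (T : R) := gen_choiceMixin (plan T).

Definition dplan (R : realType) (T : R) (C : plan T) :
    {measure set (measurableTypeR R) -> \bar R} :=
  lebesgue_stieltjes_measure (plan_fun C).

(** Weak convergence of finite measures on [0,T]: the coarsest topology that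
    makes [C |-> \int phi dC] continuous for every [phi] continuous on [0,T]. *)
Definition test_function (R : realType) (T : R) :=
  {phi : R -> R | {within `[0, T], continuous phi}}.

Definition test_integrals (R : realType) (T : R) (C : plan T) :
    prod_topology (fun _ : test_function T => R : topologicalType) :=
  fun phi => \int[dplan C]_(t in `[0, T]) sval phi t.

HB.instance Definition _ (R : realType) (T : R) :=
  Topological.copy (plan T) (initial_topology (@test_integrals R T)).

Lemma plan_ext (R : realType) (T : R) (C D : plan T) :
  (forall t, C t = D t) -> C = D.
Proof.
case: C D => [c c1 c2 c3 c4] [d d1 d2 d3 d4] /= /funext cd; subst d.
by congr Plan; exact: Prop_irrelevance.
Qed.

Section mix.
Context (R : realType) (T : R) (l : {i01 R}) (C D : plan T).

Let m (t : R) := l%:num * C t + (1 - l%:num) * D t.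

Let m_nondecreasing : nondecreasing m.
Proof.
by move=> s t st; apply: lerD; apply: ler_wpM2l => //;
  exact: plan_nondecreasing.
Qed.

Let m_right_continuous : right_continuous m.
Proof.
move=> t; apply: cvgD; apply: cvgMl_tmp; exact: plan_right_continuous.
Qed.

Let m_lt0 t : t < 0 -> m t = 0.
Proof. by move=> t0; rewrite /m !plan_lt0// !mulr0 addr0. Qed.

Let m_geT t : T <= t -> m t = m T.
Proof. by move=> Tt; rewrite /m !(plan_geT _ Tt). Qed.

Definition plan_mix : plan T :=
  Plan m_nondecreasing m_right_continuous m_lt0 m_geT.

End mix.

Section convex_plan.
Context (R : realType) (T : R).
Implicit Types (l : {i01 R}) (C D : plan T).

Let mix1 C D : plan_mix 1%:i01 C D = C.
Proof. by apply: plan_ext => t /=; rewrite mul1r subrr mul0r addr0. Qed.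

Let mixmm l C : plan_mix l C C = C.
Proof. by apply: plan_ext => t /=; rewrite -mulrDl addrC subrK mul1r. Qed.

Let mixC l C D : plan_mix l C D = plan_mix (1 - l%:inum)%:i01 D C.
Proof. by apply: plan_ext => t /=; rewrite addrC subKr. Qed.

Let mixA : convex_quasi_associative (@plan_mix R T).
Proof.
move=> p q r s a b c prs spq; apply: plan_ext => t /=.
rewrite !mulrDr !mulrA [s%:num * _]mulrC -prs.
by rewrite -(ConvexQuasiAssoc.pq_sr prs spq) -spq addrA.
Qed.

HB.instance Definition _ :=
  isConvexSpace.Build R (plan T) mix1 mixmm mixC mixA.

End convex_plan.

Definition budget_set (R : realType) (T : R) (psi : R -> R) (w : R) :
    set (plan T) :=
  [set C | \int[dplan C]_(t in `[0, T]) psi t <= w].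

Definition satisfaction (R : realType) (T : R) (eta : R -> R)
    (theta : R -> R -> R) (C : plan T) (t : R) : R :=
  eta t + \int[dplan C]_(s in `[0, t]) theta t s.

(** [C^1] up to the boundary on the closed half-plane [R_+ x R]: the difference
    quotients and the continuity of the gradient [g] are taken within the
    half-plane. *)
Definition C1_halfplane (R : realType) (h : R -> R -> R) : Prop :=
  let H := [set p : R * R | 0 <= p.1] in
  exists g : R * R -> R * R,
    {within H, continuous g} /\
    forall p, H p ->
      (h q.1 q.2 - h p.1 p.2
         - ((g p).1 * (q.1 - p.1) + (g p).2 * (q.2 - p.2))) / `|q - p|
        @[q --> within H p^'] --> 0.

Definition strictly_concave_halfplane (R : realType) (h : R -> R -> R) : Prop :=
  forall (y u y' u' l : R), 0 <= y -> 0 <= y' -> (y, u) != (y', u') ->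
    0 < l < 1 ->
    l * h y u + (1 - l) * h y' u'
      < h (l * y + (1 - l) * y') (l * u + (1 - l) * u').

Definition aggregator_measurable (R : realType) (T : R)
    (f : R -> R -> R -> R) : Prop :=
  forall y u, 0 <= y -> measurable_fun `[0, T] (fun s => f s y u).

Definition assumption_a1 (R : realType) (T : R) (f : R -> R -> R -> R) : Prop :=
  forall s, s \in `[0, T] ->
    [/\ strictly_concave_halfplane (f s),
        C1_halfplane (f s) &
        forall u y y', 0 <= y -> y < y' -> f s y u < f s y' u].

Definition assumption_a2 (R : realType) (T : R) (f : R -> R -> R -> R) : Prop :=
  exists K : R, 0 < K /\
    forall s y u u', s \in `[0, T] -> 0 <= y ->
      `|f s y u - f s y u'| <= K * `|u - u'|.

Definition assumption_a3 (R : realType) (T : R) (f : R -> R -> R -> R) : Prop :=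
  exists alpha K : R, [/\ 0 < alpha < 1, 0 < K &
    forall s y, s \in `[0, T] -> 0 <= y ->
      `|f s y 0| <= K * (1 + `|y| `^ alpha)].

(** Only the values of [U] on [0,T] matter.  Integrability is required
    explicitly because the integral of a non-integrable function is a junk
    value. *)
Definition solution (R : realType) (T : R) (f : R -> R -> R -> R)
    (Y U : R -> R) : Prop :=
  lebesgue_measure.-integrable `[0, T] (fun s => (f s (Y s) (U s))%:E) /\
  forall t, t \in `[0, T] ->
    U t = \int[lebesgue_measure]_(s in `[t, T]) f s (Y s) (U s).

(** [U^C]: a solution, and the zero function if there is none. *)
Definition utility_process (R : realType) (T : R) (eta : R -> R)
    (theta : R -> R -> R) (f : R -> R -> R -> R) (C : plan T) : R -> R :=
  xget (fun=> 0) [set U | solution T f (satisfaction eta theta C) U].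

Local Open Scope convex_scope.

Definition concave_plan (R : realType) (T : R) (J : plan T -> R) : Prop :=
  forall (l : {i01 R}) (C D : plan T),
    l%:num * J C + (1 - l%:num) * J D <= J (C <| l |> D).

(** Strict inequality is required whenever the satisfaction levels [Y C] and
    [Y D] differ somewhere on [0,T[, not merely whenever [C <> D].  The latter
    can never hold for [J C = U^C_0], which sees [C] only through the values of
    [Y C] on [0,T[: the plans [0] and [dirac T] and all their mixtures yield
    [Y = eta] on [0,T[, hence the same utility. *)
Definition strictly_concave_plan (R : realType) (T : R)
    (Y : plan T -> R -> R) (J : plan T -> R) : Prop :=
  concave_plan J /\
  forall (l : {i01 R}) (C D : plan T), 0 < l%:num < 1 ->
    (exists2 t, t \in `[0, T[ & Y C t != Y D t) ->
    l%:num * J C + (1 - l%:num) * J D < J (C <| l |> D).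

(* Main.v *)
Require Import Defs.
From HB Require Import structures.
From mathcomp Require Import all_boot all_order all_algebra.
From mathcomp Require Import interval_inference.
From mathcomp Require Import all_classical all_reals all_analysis.
From mathcomp Require Import measurable_realfun lra.

Set Implicit Arguments.
Unset Strict Implicit.
Unset Printing Implicit Defensive.

Import Order.TTheory GRing.Theory Num.Theory.
Import numFieldNormedType.Exports.

Local Open Scope classical_set_scope.
Local Open Scope ring_scope.

(** Satisfaction levels [Y C] are bounded, and right continuous in time, hence
    measurable, so that [F s u = f s (Y C s) u] is a measurable field, Lipschitz
    in [u] with constant [K], and the equation is a backward ordinary
    differential equation in integral form.

    Existence ([solves_exists]) comes from Picard iteration, a contraction of
    ratio 1/2 in the supremum norm weighted by [expR (2 K (T - t))].  The
    difference of the solutions for two plans is at most the integral of the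
    defect [g] of the first solution in the second equation plus [K] times the
    difference itself; Gronwall's inequality ([gronwall]) turns this into the
    stability estimate ([solves_stability]), and uniqueness is the case of equal
    plans.

    For continuity ([utility_continuous]), the estimate reduces the matter to
    the convergence to 0 of an integral of
    [`|f t (Y C0 t) u - f t (Y (C n) t) u|].  A plan converging weakly to [C0] has
    satisfaction levels converging at each continuity point of [C0]
    ([satisfaction_cvg]), that is, at all but countably many times, and dominated
    convergence concludes.  Dominated convergence is about sequences, whereas the
    weak topology is given by neighbourhoods; this is bridged by a countable
    family of test functions, kernels cut off continuously at rational times,
    which already forces the convergence of satisfaction levels
    ([countable_test_continuous]).

    For concavity ([utility_mix_comparison]), the mixture [Z] of two utility
    processes is a subsolution of the equation for the mixed plan, because [Y] is
    affine in the plan and [f t] is jointly concave.  The difference [W] of the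
    solution and [Z] is the integral from [t] to [T] of a function at least
    [g - K |W|], where [g >= 0] is the concavity gap.  Hence [W >= 0]: up to the
    first time at which [W] is nonnegative again, a negative part would satisfy a
    homogeneous Gronwall inequality ([tail_integral_ge0]).  If moreover [W 0 = 0],
    a Gronwall argument forward in time gives [W = 0] and leaves no room for a
    gap of positive integral ([tail_integral_gt0]).  When the two levels differ
    at some time before [T], they differ on an interval by right continuity, and
    there the gap is positive. *)

(** * Measurable functions and integrals on intervals *)

(** Rounding [Y] up to the next multiple of [1/(n+1)] keeps it strictly on the
    right of [Y x], so that right continuity is enough to pass to the limit, and
    leaves only countably many values, on each of which [F] is frozen in its
    second argument. *)
Lemma measurable_fun_caratheodory d (X : measurableType d) (R : realType)
    (D : set X) (F : X -> R -> R) (Y : X -> R) :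
  measurable D -> (forall y, measurable_fun D (F^~ y)) ->
  (forall x, D x -> F x y @[y --> (Y x)^'+] --> F x (Y x)) ->
  measurable_fun D Y -> measurable_fun D (fun x => F x (Y x)).
Proof.
move=> mD mF rcF mY.
pose grid (n : nat) (y : R) : R :=
  (Num.floor (n.+1%:R * y) + 1)%:~R / n.+1%:R.
have grid_itv n y : y < grid n y <= y + n.+1%:R^-1.
  have /andP[lo hi] := floor_itv (n.+1%:R * y).
  rewrite /grid ltr_pdivlMr// ler_pdivrMr// mulrDl mulVf ?pnatr_eq0//.
  by rewrite mulrC hi intrD lerD2r lo.
apply: (@measurable_fun_cvg _ _ _ _ (fun n x => F x (grid n (Y x)))).
  move=> n _ B mB.
  rewrite (_ : _ `&` _ = \bigcup_(k : int)
      ((D `&` Y @^-1` `[k%:~R / n.+1%:R, (k + 1)%:~R / n.+1%:R[) `&`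
       (D `&` (F^~ ((k + 1)%:~R / n.+1%:R)) @^-1` B))).
    apply: countable_bigcupT_measurable => // k; apply: measurableI.
      by apply: mY => //; exact: measurable_itv.
    exact: mF.
  have gridE x k : `[k%:~R / n.+1%:R, (k + 1)%:~R / n.+1%:R[%classic (Y x) <->
      Num.floor (n.+1%:R * Y x) = k.
    rewrite /= in_itv/= ler_pdivrMr// ltr_pdivlMr// mulrC -floor_eq.
    by split=> /eqP.
  apply/seteqP; split => x /=.
    move=> [Dx Bx]; exists (Num.floor (n.+1%:R * Y x)) => //.
    by split; split => //; exact/gridE.
  by move=> [k _ [[Dx /gridE kE] [_ Bx]]]; split => //; rewrite /grid kE.
move=> x Dx; have /cvg_at_rightP := rcF _ Dx; apply; split.
  by move=> n; have /andP[] := grid_itv n (Y x).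
apply: (@squeeze_cvgr _ _ _ _ (cst (Y x)) (fun n => Y x + n.+1%:R^-1)).
- by apply: nearW => n; have /andP[/ltW -> ->] := grid_itv n (Y x).
- exact: cvg_cst.
- rewrite -[X in _ --> X]addr0; apply: cvgD; first exact: cvg_cst.
  exact: cvg_harmonic.
Qed.

Section integrable_closure.
Context d (X : measurableType d) (R : realType) (mu : {measure set X -> \bar R}).
Variables (D : set X) (mD : measurable D).
Implicit Types f g : X -> R.

Lemma integrable_EFinD f g : mu.-integrable D (EFin \o f) ->
  mu.-integrable D (EFin \o g) ->
  mu.-integrable D (EFin \o (fun x => f x + g x)).
Proof. by move=> fi gi; exact: (integrableD mD fi gi). Qed.

Lemma integrable_EFinB f g : mu.-integrable D (EFin \o f) ->
  mu.-integrable D (EFin \o g) ->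
  mu.-integrable D (EFin \o (fun x => f x - g x)).
Proof. by move=> fi gi; exact: (integrableB mD fi gi). Qed.

Lemma integrable_EFinZl k f : mu.-integrable D (EFin \o f) ->
  mu.-integrable D (EFin \o (fun x => k * f x)).
Proof. by move=> fi; exact: (integrableZl mD k fi). Qed.

Lemma bounded_measurable_integrable f (M : R) : (mu D < +oo)%E ->
  measurable_fun D f -> (forall x, D x -> `|f x| <= M) ->
  mu.-integrable D (EFin \o f).
Proof.
move=> Doo mf fM; apply: measurable_bounded_integrable => //.
exists M; split; first exact: num_real.
by move=> N MN x /fM /le_trans; apply; exact: ltW.
Qed.

Lemma integrable_EFinMl f (h : X -> R) (M : R) : measurable_fun D h ->
  (forall x, D x -> `|h x| <= M) -> mu.-integrable D (EFin \o f) ->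
  mu.-integrable D (EFin \o (fun x => h x * f x)).
Proof.
move=> mh hM fi; apply: (integrableMr mD mh _ fi).
exists M; split; first exact: num_real.
by move=> N MN x /hM /le_trans; apply; exact: ltW.
Qed.

Lemma ge0_subset_Rintegral (A : set X) f : measurable A -> A `<=` D ->
  mu.-integrable D (EFin \o f) -> (forall x, D x -> 0 <= f x) ->
  \int[mu]_(x in A) f x <= \int[mu]_(x in D) f x.
Proof.
move=> mA AD fi f0; have fAi := integrableS mD mA AD fi.
apply: fine_le; [exact: integrable_fin_num|exact: integrable_fin_num|].
apply: ge0_subset_integral => //; exact: measurable_int fi.
Qed.

End integrable_closure.

Lemma normr_affine_le (R : realDomainType) (a b x y M N : R) : 0 <= a -> 0 <= b ->
  `|x| <= M -> `|y| <= N -> `|a * x + b * y| <= a * M + b * N.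
Proof.
move=> a0 b0 xM yN; rewrite (le_trans (ler_normD _ _))// !normrM.
by rewrite (ger0_norm a0) (ger0_norm b0) lerD// ler_wpM2l.
Qed.

Section affine_combination.
Context d (X : measurableType d) (R : realType) (mu : {measure set X -> \bar R}).
Variables (D : set X) (mD : measurable D) (a b : R) (g h : X -> R).

Lemma measurable_affine : measurable_fun D g -> measurable_fun D h ->
  measurable_fun D (fun s => a * g s + b * h s).
Proof.
by move=> mg mh; apply: measurable_funD; apply: measurable_funM.
Qed.

Lemma Rintegral_affine : mu.-integrable D (EFin \o g) ->
  mu.-integrable D (EFin \o h) ->
  \int[mu]_(s in D) (a * g s + b * h s) =
  a * \int[mu]_(s in D) g s + b * \int[mu]_(s in D) h s.
Proof.
move=> gi hi; rewrite RintegralD//; [|exact: integrable_EFinZl..].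
by rewrite RintegralZl// RintegralZl.
Qed.

End affine_combination.

Section interval_integrals.
Context (R : realType).
Notation mu := (@lebesgue_measure R).
Implicit Types (a b c : R) (f : R -> R).

Lemma lebesgue_itvcc_lty a b : (mu `[a, b] < +oo)%E.
Proof. by rewrite lebesgue_measure_itv/=; case: ifP; rewrite ?ltry. Qed.

Lemma integrable_itvccS a b c e f : a <= c -> e <= b ->
  mu.-integrable `[a, b] (EFin \o f) -> mu.-integrable `[c, e] (EFin \o f).
Proof.
move=> ac eb; apply: integrableS => //.
by apply: subset_itv; rewrite bnd_simp.
Qed.

Lemma Rintegral_itvcc_cat a b c f : mu.-integrable `[a, b] (EFin \o f) ->
  a <= c -> c <= b ->
  \int[mu]_(t in `[a, b]) f t
  = \int[mu]_(t in `[a, c]) f t + \int[mu]_(t in `[c, b]) f t.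
Proof.
move=> fi ac cb.
have := Rintegral_itvB fi (x := c); rewrite !bnd_simp => /(_ ac cb).
rewrite Rintegral_itv_obnd_cbnd; first by move=> <-; rewrite addrC subrK.
by apply: integrableS fi => //; apply: subset_itv; rewrite bnd_simp.
Qed.

Lemma Rintegral_itvcc_cst a b (k : R) : a <= b ->
  \int[mu]_(t in `[a, b]) k = k * (b - a).
Proof.
move=> ab; rewrite Rintegral_cst//; congr (_ * _).
suff muab : mu `[a, b] = (b - a)%:E by exact: (congr1 fine muab).
rewrite lebesgue_measure_itv/= lte_fin.
by move: ab; rewrite le_eqVlt => /predU1P[->|->//]; rewrite ltxx subrr.
Qed.

Lemma normr_Rintegral_itvcc_le a b f (M : R) : a <= b ->
  mu.-integrable `[a, b] (EFin \o f) ->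
  (forall t, t \in `[a, b] -> `|f t| <= M) ->
  `|\int[mu]_(t in `[a, b]) f t| <= M * (b - a).
Proof.
move=> ab fi fM; rewrite -Rintegral_itvcc_cst//.
apply: le_trans (le_normr_Rintegral _ fi) _ => //.
apply: le_Rintegral => //; first exact: integrable_norm.
apply: (bounded_measurable_integrable _ (M := `|M|)) => //.
exact: lebesgue_itvcc_lty.
Qed.

(** The exponential weight reproduces itself under integration; weighting a
    supremum norm by it turns an integral operator of Lipschitz constant [K]
    into a contraction as soon as [K < `|c|]. *)
Lemma Rintegral_expR x y (c z : R) : x <= y ->
  \int[mu]_(t in `[x, y]) (c * expR (c * (t - z)))
  = expR (c * (y - z)) - expR (c * (x - z)).
Proof.
rewrite le_eqVlt => /predU1P[->|xy].
  by rewrite set_itv1 Rintegral_set1 subrr.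
have cexp : continuous (fun t => expR (c * (t - z))).
  move=> t; apply: continuous_comp; last exact: continuous_expR.
  by apply: cvgM; [exact: cvg_cst|apply: cvgB; [exact: cvg_id|exact: cvg_cst]].
rewrite /Rintegral (@continuous_FTC2 _ _ (fun t => expR (c * (t - z))))//.
- apply: continuous_subspaceT => t.
  by apply: cvgM; [exact: cvg_cst|exact: cexp].
- split => //.
  + exact/cvg_at_right_filter/cexp.
  + exact/cvg_at_left_filter/cexp.
- move=> t _; rewrite derive1E; apply: derive_val.
  rewrite mulrC.
  apply: (@is_derive1_comp _ expR (fun t => c * (t - z)) t).
  apply: is_derive_eq; rewrite subr0; exact: mulr1.
Qed.

End interval_integrals.

Lemma ae_itvoo_itvcc (R : realType) (a b : R) (P : R -> Prop) :
  {ae (@lebesgue_measure R), forall t, t \in `]a, b[ -> P t} ->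
  {ae (@lebesgue_measure R), forall t, t \in `[a, b] -> (t \in `]a, b[) /\ P t}.
Proof.
move=> aeP; set mu := @lebesgue_measure R.
have FF : Filter (almost_everywhere mu) by exact: ae_filter_ringOfSetsType.
have ne x : {ae mu, forall t : R, t != x}.
  exists [set x]; split => //; first exact: lebesgue_measure_set1.
  by move=> t /= /negP; rewrite negbK => /eqP.
apply: filterS3 aeP (ne a) (ne b) => t Pt ta tb; rewrite in_itv/= => /andP[at_ tb'].
have tab : t \in `]a, b[ by rewrite in_itv/= !lt_neqAle eq_sym ta at_ tb' tb.
by split => //; exact: Pt.
Qed.

Lemma Rintegral_itvcc_cvg0 (R : realType) (a b : R) (g : nat -> R -> R) (N : R) :
  (forall n, measurable_fun `[a, b] (g n)) ->
  (forall n t, t \in `[a, b] -> `|g n t| <= N) ->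
  {ae (@lebesgue_measure R), forall t, t \in `[a, b] -> g n t @[n --> \oo] --> 0} ->
  \int[@lebesgue_measure R]_(t in `[a, b]) g n t @[n --> \oo] --> 0.
Proof.
move=> mg gN g0; set mu := @lebesgue_measure R.
have Ni : mu.-integrable `[a, b] (fun t => N%:E).
  apply: (bounded_measurable_integrable _ (f := cst N) (M := `|N|)) => //.
  exact: lebesgue_itvcc_lty.
have FF : Filter (almost_everywhere mu) by exact: ae_filter_ringOfSetsType.
have ge0 : {ae mu, forall t, `[a, b]%classic t ->
    (g n t)%:E @[n --> \oo] --> cst 0%E t}.
  by apply: filterS g0 => t gt /= /gt gt'; apply: cvg_EFin => //; exact: nearW.
have gNe : {ae mu, forall t, forall n, `[a, b]%classic t ->
    (`|(g n t)%:E| <= N%:E)%E}.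
  by apply: aeW => t n /= tab; rewrite lee_fin gN.
have mab : measurable (`[a, b]%classic : set (measurableTypeR R)).
  exact: measurable_itv.
have mge n : @measurable_fun _ _ (measurableTypeR R) _ `[a, b] (EFin \o g n).
  by apply/measurable_EFinP; exact: mg.
have m0 : @measurable_fun _ _ (measurableTypeR R) _ `[a, b] (cst (0%E : \bar R)).
  exact: measurable_cst.
have [_ _] := dominated_convergence mab mge m0 ge0 Ni gNe.
by rewrite integral0 => /fine_cvg.
Qed.

Lemma Rintegral_itvcc_gt0 (R : realType) (a b x y : R) (g : R -> R) :
  (@lebesgue_measure R).-integrable `[a, b] (EFin \o g) ->
  (forall s, s \in `[a, b] -> 0 <= g s) -> a <= x -> x < y -> y <= b ->
  (forall s, s \in `]x, y[ -> 0 < g s) ->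
  0 < \int[@lebesgue_measure R]_(s in `[a, b]) g s.
Proof.
set mu := @lebesgue_measure R => gi g0 ax xy yb gpos.
rewrite lt_neqAle eq_sym Rintegral_ge0 ?andbT//; apply/negP => /eqP I0.
have mab : measurable (`[a, b]%classic : set (measurableTypeR R)).
  exact: measurable_itv.
have absg0 : (\int[mu]_(s in `[a, b]) `|(EFin \o g) s| = 0)%E.
  transitivity (\int[mu]_(s in `[a, b]) (g s)%:E)%E.
    apply: eq_integral => s; rewrite inE/= => sab.
    by rewrite /= ger0_norm ?g0.
  have fi := integrable_fin_num mab gi.
  by rewrite -(fineK fi); exact: (congr1 EFin I0).
have [N [mN N0 gN]] := (ae_eq_integral_abs mu mab (measurable_int mu gi)).1 absg0.
have muxy : mu `]x, y[%classic = (y - x)%:E.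
  by rewrite /mu lebesgue_measure_itv/= lte_fin xy.
suff : ((y - x)%:E <= 0)%E by rewrite lee_fin subr_le0 leNgt xy.
rewrite -muxy -[leRHS]N0; apply: le_measure; rewrite ?inE//.
move=> s sxy; apply: gN => /= gs.
have sab : s \in `[a, b].
  move: sxy; rewrite /= !in_itv/= => /andP[xs sy].
  by rewrite (le_trans ax (ltW xs)) (le_trans (ltW sy) yb).
have [gs0] := gs sab; have := gpos s sxy.
by rewrite gs0 ltxx.
Qed.

(** * Gronwall inequalities *)

Section gronwall.
Context (R : realType) (a b K : R).
Notation mu := (@lebesgue_measure R).
Implicit Types (d g : R -> R).

Lemma integrable_expR_weight (s k x y : R) g : 0 <= k ->
  mu.-integrable `[x, y] (EFin \o g) ->
  mu.-integrable `[x, y] (EFin \o (fun t => expR (k * (t - s)) * g t)).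
Proof.
move=> k0 gi; apply: (integrable_EFinMl _ (M := expR (k * (y - s)))) => //.
  apply: subspace_continuous_measurable_fun => //; apply: continuous_subspaceT => t.
  apply: continuous_comp; last exact: continuous_expR.
  by apply: cvgM; [exact: cvg_cst|apply: cvgB; [exact: cvg_id|exact: cvg_cst]].
move=> t /=; rewrite in_itv/= => /andP[_ ty].
by rewrite ger0_norm ?expR_ge0// ler_expR ler_wpM2l// lerD2r.
Qed.

(** Over a time step short enough that [K (r - s) <= 1/2], the running integral
    [L] controls its own integrand, so that [L s] exceeds [L r] plus the
    forcing term by a factor at most [expR (2 K (r - s))]; these factors
    multiply along a subdivision, and its mesh is then sent to 0. *)
Lemma gronwall d g : 0 < K ->
  mu.-integrable `[a, b] (EFin \o d) -> mu.-integrable `[a, b] (EFin \o g) ->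
  (forall s, s \in `[a, b] -> 0 <= d s) ->
  (forall s, s \in `[a, b] -> 0 <= g s) ->
  (forall s, s \in `[a, b] ->
     d s <= \int[mu]_(t in `[s, b]) (g t + K * d t)) ->
  forall s, s \in `[a, b] ->
    d s <= \int[mu]_(t in `[s, b]) (expR (2 * K * (t - s)) * g t).
Proof.
move=> K_gt0 di gi d0 g0 dL.
pose L s := \int[mu]_(t in `[s, b]) (g t + K * d t).
pose M s := \int[mu]_(t in `[s, b]) (expR (2 * K * (t - s)) * g t).
have K2 : 0 <= 2 * K by lra.
have sub x y c e : a <= x -> y <= b -> x <= c -> e <= y ->
    forall t, t \in `[c, e] -> t \in `[a, b].
  by move=> ? ? ? ? t; rewrite !in_itv/= => /andP[? ?]; apply/andP; split; lra.
have gdi : mu.-integrable `[a, b] (EFin \o (fun t => g t + K * d t)).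
  by apply: integrable_EFinD => //; exact: integrable_EFinZl.
have gd0 t : t \in `[a, b] -> 0 <= g t + K * d t.
  by move=> tab; rewrite addr_ge0// ?g0// mulr_ge0 ?d0//; lra.
have L_le s r : a <= s -> s <= r -> r <= b -> L r <= L s.
  move=> as_ sr rb; rewrite /L [leRHS](@Rintegral_itvcc_cat _ _ _ r)//; last first.
    exact: integrable_itvccS gdi.
  rewrite lerDr; apply: Rintegral_ge0 => t /= ?; apply: gd0.
  by apply: (sub a b s r).
have step s r : a <= s -> s <= r -> r <= b -> K * (r - s) <= 2^-1 ->
    L s <= expR (2 * K * (r - s)) * (L r + \int[mu]_(t in `[s, r]) g t).
  move=> as_ sr rb Krs.
  set G := \int[mu]_(t in `[s, r]) g t.
  have dLs : \int[mu]_(t in `[s, r]) d t <= L s * (r - s).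
    rewrite -Rintegral_itvcc_cst//; apply: le_Rintegral => //.
    - exact: integrable_itvccS di.
    - apply: (bounded_measurable_integrable _ (M := `|L s|)) => //.
      exact: lebesgue_itvcc_lty.
    - move=> t /= tsr; have tab : t \in `[a, b] by apply: (sub a b s r).
      apply: le_trans (dL _ tab) _; move: tsr; rewrite in_itv/= => /andP[st tr].
      by apply: L_le => //; lra.
  have Ls : L s <= L r + G + K * (r - s) * L s.
    rewrite {1}/L (@Rintegral_itvcc_cat _ _ _ r)//; last first.
      exact: integrable_itvccS gdi.
    rewrite RintegralD//; last 2 first.
    - exact: integrable_itvccS gi.
    - by apply: integrable_EFinZl => //; exact: integrable_itvccS di.
    rewrite RintegralZl//; last exact: integrable_itvccS di.
    have := ler_wpM2l (ltW K_gt0) dLs.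
    by rewrite -/G -/(L r) mulrCA mulrA => ?; lra.
  have LG0 : 0 <= L r + G.
    rewrite addr_ge0//; apply: Rintegral_ge0 => t /= ?.
      by apply: gd0; apply: (sub a b r b) => //; lra.
    by apply: g0; apply: (sub a b s r).
  apply: le_trans (_ : (1 + 2 * K * (r - s)) * (L r + G) <= _); last first.
    by rewrite ler_wpM2r// expR_ge1Dx.
  have Ls0 : 0 <= L s.
    apply: Rintegral_ge0 => t /= ?; apply: gd0.
    by apply: (sub a b s b) => //; lra.
  have : 0 <= K * (r - s) by rewrite mulr_ge0//; lra.
  rewrite -mulrA; move: (K * (r - s)) Krs Ls => x x2 Ls x0.
  (* [(1 + 2 x) (1 - x) >= 1] on [[0, 1/2]], and [1 + 2 x <= expR (2 x)]. *)
  have x21 : 0 <= 1 + 2 * x by lra.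
  have := ler_wpM2l x21 (_ : (1 - x) * L s <= L r + G).
  have : 0 <= x * (1 - 2 * x) * L s by rewrite !mulr_ge0//; lra.
  by move=> ? /(_ ltac:(lra)); lra.
have M0 s : s \in `[a, b] -> 0 <= M s.
  rewrite in_itv/= => /andP[as_ sb].
  apply: Rintegral_ge0 => t /= ?; rewrite mulr_ge0 ?expR_ge0//; apply: g0.
  by apply: (sub a b s b) => //; lra.
have wi s : s \in `[a, b] ->
    mu.-integrable `[s, b] (EFin \o (fun t => expR (2 * K * (t - s)) * g t)).
  rewrite in_itv/= => /andP[as_ sb].
  by apply: integrable_expR_weight => //; exact: integrable_itvccS gi.
have grid h n : 0 < h -> K * h <= 2^-1 -> forall s, s \in `[a, b] ->
    b - s <= n%:R * h -> L s <= expR (2 * K * h) * M s.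
  move=> h0 Kh; elim: n => [|n IH] s sab bs.
    move: (sab); rewrite in_itv/= => /andP[as_ sb].
    have -> : s = b by lra.
    rewrite /L set_itv1 Rintegral_set1 mulr_ge0 ?expR_ge0//; apply: M0.
    by rewrite in_itv/=; apply/andP; split; lra.
  move: (sab); rewrite in_itv/= => /andP[as_ sb].
  pose r := Num.min b (s + h).
  have sr : s <= r by rewrite le_min sb lerDl ltW.
  have rb : r <= b by rewrite ge_min lexx.
  have rsh : r - s <= h by rewrite lerBlDl ge_min lexx orbT.
  have brn : b - r <= n%:R * h.
    move: bs; rewrite -natr1 mulrDl mul1r => bs.
    have [->|->] : r = b \/ r = s + h; last by lra.
      by rewrite /r; case: leP => _; [left|right].
    by rewrite subrr mulr_ge0// ltW.
  have rab : r \in `[a, b] by rewrite in_itv/=; apply/andP; split; lra.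
  have {}IH := IH r rab brn.
  have Krs : K * (r - s) <= K * h by rewrite ler_wpM2l// ltW.
  apply: le_trans (step s r as_ sr rb (le_trans Krs Kh)) _.
  rewrite mulrDr /M (@Rintegral_itvcc_cat _ _ _ r)//; last exact: wi.
  rewrite [leLHS]addrC [leRHS]mulrDr; apply: lerD.
    apply: ler_pM; rewrite ?expR_ge0 ?ler_expR//.
    - by apply: Rintegral_ge0 => t /= ?; apply: g0; apply: (sub a b s r).
    - by rewrite ler_wpM2l//; lra.
    apply: le_Rintegral => //.
    - exact: integrable_itvccS gi.
    - exact: integrable_itvccS (wi _ sab).
    - move=> t /= tsr; rewrite ler_peMl//.
        by apply: g0; apply: (sub a b s r).
      rewrite -[leLHS]expR0 ler_expR mulr_ge0//; move: tsr.
      by rewrite in_itv/=; lra.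
  have -> : \int[mu]_(t in `[r, b]) (expR (2 * K * (t - s)) * g t) =
      \int[mu]_(t in `[r, b]) (expR (2 * K * (r - s)) *
        (expR (2 * K * (t - r)) * g t)).
    apply: eq_Rintegral => t _; rewrite mulrA -expRD -mulrDr.
    by rewrite [r - s + _]addrC addrA subrK.
  rewrite RintegralZl//; last exact: wi.
  by rewrite mulrCA ler_wpM2l// expR_ge0.
move=> s sab; apply: le_trans (dL _ sab) _; rewrite -/(L s) -/(M s).
(* The step [h] is sent to 0 in the bound by [expR (2 K h) M s]. *)
have lim : expR (2 * K * h) * M s @[h --> 0^'+] --> M s.
  rewrite [X in _ --> X](_ : M s = expR (2 * K * 0) * M s); last first.
    by rewrite mulr0 expR0 mul1r.
  apply: cvg_at_right_filter; apply: cvgM; last exact: cvg_cst.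
  apply: continuous_comp; last exact: continuous_expR.
  by apply: cvgM; [exact: cvg_cst|exact: cvg_id].
rewrite -(cvg_lim _ lim)//; apply: limr_ge; first by apply/cvg_ex; exists (M s).
near=> h.
have h0 : 0 < h by near: h; exact: nbhs_right_gt.
apply: (grid h (Num.trunc ((b - s) / h)).+1) => //.
  rewrite mulrC -ler_pdivlMr//; apply: ltW; near: h; apply: nbhs_right_lt.
  by rewrite divr_gt0// invr_gt0.
by rewrite -ler_pdivrMr// ltW// truncnS_gt.
Unshelve. all: by end_near. Qed.

End gronwall.

Section tail_integral.
Context (R : realType) (a b : R).
Notation mu := (@lebesgue_measure R).
Implicit Types (q W : R -> R).

Lemma tail_integral_sub q W :
  mu.-integrable `[a, b] (EFin \o q) ->
  (forall t, t \in `[a, b] -> W t = \int[mu]_(s in `[t, b]) q s) ->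
  forall x y, a <= x -> x <= y -> y <= b ->
    W x = \int[mu]_(s in `[x, y]) q s + W y.
Proof.
move=> qi Wq x y ax xy yb.
have xab : x \in `[a, b] by rewrite in_itv/= ax (le_trans xy).
have yab : y \in `[a, b] by rewrite in_itv/= yb (le_trans ax).
rewrite (Wq x xab) (Wq y yab); apply: Rintegral_itvcc_cat => //.
exact: integrable_itvccS qi.
Qed.

Lemma tail_integral_lipschitz q W (B : R) :
  mu.-integrable `[a, b] (EFin \o q) ->
  (forall t, t \in `[a, b] -> `|q t| <= B) ->
  (forall t, t \in `[a, b] -> W t = \int[mu]_(s in `[t, b]) q s) ->
  forall x y, x \in `[a, b] -> y \in `[a, b] -> `|W x - W y| <= B * `|x - y|.
Proof.
move=> qi qB Wq x y.
wlog xy : x y / x <= y.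
  move=> H xab yab; case: (leP x y) => [|/ltW] xy; first exact: H.
  by rewrite distrC [`|x - y|]distrC; exact: H.
rewrite !in_itv/= => /andP[ax xb] /andP[ay yb].
rewrite (tail_integral_sub qi Wq ax xy yb) addrK.
rewrite [`|x - y|]distrC [`|y - x|]ger0_norm ?subr_ge0//.
apply: normr_Rintegral_itvcc_le => //; first exact: integrable_itvccS qi.
move=> t; rewrite in_itv/= => /andP[xt ty]; apply: qB.
by rewrite in_itv/= (le_trans ax xt) (le_trans ty yb).
Qed.

Lemma lipschitz_itvcc_measurable W (B : R) :
  (forall x y, x \in `[a, b] -> y \in `[a, b] -> `|W x - W y| <= B * `|x - y|) ->
  measurable_fun `[a, b] W.
Proof.
move=> WB.
have [ba|ab] := ltP b a.
  by rewrite set_itv_ge ?bnd_simp -?ltNge//; exact: measurable_fun_set0.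
(* Clamping to [[a, b]] extends [W] to a continuous function on the line. *)
pose c (x : R) := Num.max a (Num.min b x).
have c_ab x : c x \in `[a, b].
  by rewrite in_itv/= /c le_max lexx/= ge_max ab ge_min lexx.
have c_id x : x \in `[a, b] -> c x = x.
  by rewrite in_itv/= => /andP[ax xb]; rewrite /c (min_idPr xb) (max_idPr ax).
have cc : continuous c.
  move=> x; apply: continuous_max; first exact: cvg_cst.
  by apply: continuous_min; [exact: cvg_cst|exact: cvg_id].
apply: (@eq_measurable_fun _ _ _ _ _ (W \o c)).
  by move=> x; rewrite inE/= => xab; rewrite /= c_id.
apply: measurable_funTS; apply: continuous_measurable_fun => x.
apply/cvgrPdist_lt => e e0.
have B0 : 0 < `|B| + 1 by rewrite ltr_wpDl.
have /cvgrPdist_lt/(_ (e / (`|B| + 1))) := cc x.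
rewrite divr_gt0// => /(_ isT); apply: filterS => y.
rewrite ltr_pdivlMr// => h; apply: le_lt_trans h.
apply: le_trans (WB _ _ (c_ab x) (c_ab y)) _; rewrite mulrC ler_wpM2l//.
by rewrite (le_trans (ler_norm B))// lerDl.
Qed.

(** Up to the first time [r1] at which [W] is nonnegative again, [|W| = - W]
    satisfies a homogeneous Gronwall inequality on [[x, r1]], so [W x < 0] is
    impossible. *)
Lemma tail_integral_ge0 (K B : R) q W : 0 < K ->
  mu.-integrable `[a, b] (EFin \o q) ->
  (forall t, t \in `[a, b] -> `|q t| <= B) ->
  (forall t, t \in `[a, b] -> W t = \int[mu]_(s in `[t, b]) q s) ->
  (forall t, t \in `[a, b] -> - (K * `|W t|) <= q t) ->
  forall t, t \in `[a, b] -> 0 <= W t.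
Proof.
move=> K0 qi qB Wq qW x xab; rewrite leNgt; apply/negP => Wx0.
have WL := tail_integral_lipschitz qi qB Wq.
have mW := lipschitz_itvcc_measurable WL.
move: (xab); rewrite in_itv/= => /andP[ax xb].
have Wb : W b = 0.
  by rewrite Wq ?set_itv1 ?Rintegral_set1// in_itv/= lexx (le_trans ax xb).
pose S := [set r | r \in `[x, b] /\ 0 <= W r].
have S0 : has_inf S.
  split; first by exists b; rewrite /S/= Wb lexx in_itv/= xb lexx.
  by exists x => r [/=]; rewrite in_itv/= => /andP[].
pose r1 := inf S.
have xr1 : x <= r1.
  by apply: lb_le_inf S0.1 _ => r [/=]; rewrite in_itv/= => /andP[].
have r1b : r1 <= b.
  by apply: ge_inf; [exact: S0.2|rewrite /S/= Wb lexx in_itv/= xb lexx].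
have r1ab : r1 \in `[a, b] by rewrite in_itv/= (le_trans ax xr1).
have sub t : t \in `[x, r1] -> t \in `[a, b].
  by rewrite !in_itv/= => /andP[? ?]; rewrite (le_trans ax)// (le_trans _ r1b).
have Wr1 : 0 <= W r1.
  apply/ler_addgt0Pr => e e0.
  have B0 : 0 < `|B| + 1 by rewrite ltr_wpDl.
  have [r [rxb Wr] rr1] := inf_adherent (divr_gt0 e0 B0) S0.
  have r1r : r1 <= r by apply: ge_inf; [exact: S0.2|split].
  have rab : r \in `[a, b].
    by move: rxb; rewrite !in_itv/= => /andP[? ->]; rewrite (le_trans ax).
  have := WL _ _ rab r1ab; rewrite [`|r - r1|]ger0_norm ?subr_ge0//.
  have : (`|B| + 1) * (r - r1) <= e.
    by rewrite mulrC -ler_pdivlMr// lerBlDl ltW.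
  have : B * (r - r1) <= (`|B| + 1) * (r - r1).
    by rewrite ler_wpM2r ?subr_ge0// (le_trans (ler_norm B))// lerDl.
  have := ler_norm (W r - W r1); lra.
have Wneg t : x <= t -> t < r1 -> W t < 0.
  move=> xt tr1; rewrite ltNge; apply/negP => Wt.
  have : r1 <= t.
    by apply: ge_inf; [exact: S0.2|split; rewrite ?in_itv/= ?xt ?(le_trans (ltW tr1))].
  by rewrite leNgt tr1.
have Wi : mu.-integrable `[x, r1] (EFin \o W).
  apply: (bounded_measurable_integrable _ (M := `|W x| + `|B| * (r1 - x))) => //.
  - exact: lebesgue_itvcc_lty.
  - by apply: measurable_funS mW => // t /= /sub.
  - move=> t /= txr; have tab := sub t txr.
    rewrite -[W t](subrK (W x)) addrC (le_trans (ler_normD _ _))// lerD2l.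
    apply: le_trans (WL _ _ tab xab) _.
    move: txr; rewrite in_itv/= => /andP[xt tr].
    rewrite [`|t - x|]ger0_norm ?subr_ge0//; apply: ler_pM; rewrite ?subr_ge0 ?ler_norm//.
      by apply: le_trans (qB _ xab); rewrite normr_ge0.
    by rewrite lerD2r.
have Wr1_0 : W r1 = 0.
  apply/eqP; rewrite eq_le Wr1 andbT; apply/ler_addgt0Pr => e e0.
  have B0 : 0 < `|B| + 1 by rewrite ltr_wpDl.
  have xr : x < r1.
    rewrite lt_neqAle xr1 andbT; apply: contraTneq Wx0 => ->.
    by rewrite -leNgt.
  pose t := Num.max x (r1 - e / (`|B| + 1)).
  have xt : x <= t by rewrite le_max lexx.
  have tr : t < r1 by rewrite gt_max xr/= ltrBlDr ltrDl divr_gt0.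
  have tab : t \in `[a, b] by apply: sub; rewrite in_itv/= xt ltW.
  have := WL _ _ r1ab tab; rewrite [`|r1 - t|]ger0_norm ?subr_ge0//; last exact: ltW.
  have : (`|B| + 1) * (r1 - t) <= e.
    by rewrite mulrC -ler_pdivlMr// lerBlDl -lerBlDr le_max lexx orbT.
  have : B * (r1 - t) <= (`|B| + 1) * (r1 - t).
    by rewrite ler_wpM2r ?subr_ge0 ?(ltW tr)// (le_trans (ler_norm B))// lerDl.
  have := ler_norm (W r1 - W t); have := Wneg _ xt tr; lra.
have WN t : t \in `[x, r1] -> `|W t| = - W t.
  rewrite in_itv/= => /andP[xt]; rewrite le_eqVlt => /predU1P[->|tr].
    by rewrite Wr1_0 normr0 oppr0.
  by rewrite ltr0_norm// Wneg.
have qri : mu.-integrable `[x, r1] (EFin \o q) by exact: integrable_itvccS qi.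
have c0i : mu.-integrable `[x, r1] (EFin \o cst 0) by exact: integrable0.
have := @gronwall _ x r1 K (fun t => `|W t|) (cst 0) K0 (integrable_norm Wi) c0i.
move=> /(_ ltac:(by []) ltac:(by []) _ x) H.
have : `|W x| <= 0.
  apply: le_trans (H _ _) _; last 2 first.
  - by rewrite in_itv/= lexx.
  - have -> : \int[mu]_(t in `[x, r1]) (expR (2 * K * (t - x)) * cst 0 t)
      = \int[mu]_(t in `[x, r1]) 0 by apply: eq_Rintegral => t _; exact: mulr0.
    by rewrite Rintegral_itvcc_cst// mul0r.
  move=> t txr; rewrite WN//; move: (txr); rewrite in_itv/= => /andP[xt tr].
  rewrite (tail_integral_sub qi Wq (le_trans ax xt) tr r1b) Wr1_0 addr0.
  have qti : mu.-integrable `[t, r1] (EFin \o q) by exact: integrable_itvccS qri.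
  rewrite -mulN1r -RintegralZl//; apply: le_Rintegral => //.
  - exact: integrable_EFinZl.
  - apply: integrable_EFinD => //; first exact: integrable0.
    apply: integrable_EFinZl => //; apply: integrable_norm.
    exact: integrable_itvccS Wi.
  - move=> s /=; rewrite in_itv/= => /andP[ts sr].
    have sab : s \in `[a, b] by apply: sub; rewrite in_itv/= (le_trans xt ts).
    by rewrite mulN1r add0r lerNl qW.
by rewrite normr_le0 => /eqP Wx; rewrite Wx ltxx in Wx0.
Qed.
End tail_integral.

Section halving.
Context (R : realType).
Implicit Types (x C : R) (u : R^nat).

Lemma halving_le0 x C : (forall n, x <= C / 2 ^+ n) -> x <= 0.
Proof.
move=> xC; rewrite leNgt; apply/negP => x0.
pose n := (Num.trunc (C / x)).+1.
have : C / x < 2 ^+ n.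
  apply: lt_trans (truncnS_gt _) _; rewrite -natrX ltr_nat.
  exact: ltn_expl.
rewrite ltr_pdivrMr// mulrC -ltr_pdivrMr ?exprn_gt0// => Cx.
by have := le_lt_trans (xC n) Cx; rewrite ltxx.
Qed.

(** Nested intervals: widened by [2 C / 2 ^+ n], the terms [u n] are the centres
    of a decreasing sequence of intervals. *)
Lemma halving_limit u C : (forall n, `|u n.+1 - u n| <= C / 2 ^+ n) ->
  exists l, forall n, `|l - u n| <= 2 * C / 2 ^+ n.
Proof.
move=> uC.
have C0 : 0 <= C by have := uC 0%N; rewrite expr0 divr1; exact: le_trans.
pose e n := 2 * C / 2 ^+ n.
have e0 n : 0 <= e n by rewrite /e divr_ge0 ?exprn_ge0// mulr_ge0.
have eS n : e n = C / 2 ^+ n + e n.+1.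
  rewrite /e exprS invfM mulrA [2 * C / 2]mulrC mulKf ?pnatr_eq0// -mulrDl.
  by congr (_ / _); lra.
have lo m n : (m <= n)%N -> u m - e m <= u n - e n.
  elim: n => [|n IH]; first by rewrite leqn0 => /eqP ->.
  rewrite leq_eqVlt => /predU1P[->//|/IH/le_trans]; apply.
  have := uC n; rewrite ler_norml (eS n) => /andP[+ _]; lra.
have hi m n : (m <= n)%N -> u n + e n <= u m + e m.
  elim: n => [|n IH]; first by rewrite leqn0 => /eqP ->.
  rewrite leq_eqVlt => /predU1P[->//|/IH]; apply: le_trans.
  have := uC n; rewrite ler_norml (eS n) => /andP[_]; lra.
have lohi m n : u m - e m <= u n + e n.
  have [mn|/ltnW nm] := leqP m n.
    by apply: le_trans (lo _ _ mn) _; have := e0 n; lra.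
  by apply: le_trans (hi _ _ nm); have := e0 m; lra.
pose A := range (fun n => u n - e n).
have supA : has_sup A.
  split; first by exists (u 0%N - e 0%N), 0%N.
  by exists (u 0%N + e 0%N) => _ [n _ <-].
exists (sup A) => n; rewrite ler_distl; apply/andP; split.
  by apply: sup_upper_bound => //; exists n.
by apply: ge_sup => //; [exact: supA.1|move=> _ [m _ <-]].
Qed.

End halving.

Section tail_integral_gt0.
Context (R : realType) (a b : R).
Notation mu := (@lebesgue_measure R).
Implicit Types (q W g : R -> R).

(** If [W a] vanished, [W] would satisfy the forward inequality
    [W r <= K \int_a^r W], whose iteration in the norm weighted by
    [expR (2 K (r - a))] forces [W = 0], and no forcing term [g] would be
    left. *)
Lemma tail_integral_gt0 (K B : R) q W g : 0 < K -> a <= b ->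
  mu.-integrable `[a, b] (EFin \o q) ->
  (forall t, t \in `[a, b] -> `|q t| <= B) ->
  (forall t, t \in `[a, b] -> W t = \int[mu]_(s in `[t, b]) q s) ->
  mu.-integrable `[a, b] (EFin \o g) ->
  (forall t, t \in `[a, b] -> 0 <= g t) ->
  (forall t, t \in `[a, b] -> g t - K * `|W t| <= q t) ->
  0 < \int[mu]_(t in `[a, b]) g t -> 0 < W a.
Proof.
move=> K0 ab qi qB Wq gi g0 gq.
have aab : a \in `[a, b] by rewrite in_itv/= lexx.
have W0 : forall t, t \in `[a, b] -> 0 <= W t.
  apply: (tail_integral_ge0 K0 qi qB Wq) => t tab.
  by apply: le_trans (gq _ tab); rewrite lerBrDr addNr g0.
have WL := tail_integral_lipschitz qi qB Wq.
have B0 : 0 <= B by apply: le_trans (qB _ aab).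
apply: contraPT; rewrite -leNgt => Wa.
have {}Wa : W a = 0 by apply/eqP; rewrite eq_le Wa W0.
pose M := B * (b - a).
have WM t : t \in `[a, b] -> W t <= M.
  move=> tab; have := WL _ _ tab aab; rewrite Wa subr0 ger0_norm ?W0// => /le_trans.
  apply; move: tab; rewrite in_itv/= => /andP[at_ tb].
  by rewrite ger0_norm ?subr_ge0// ler_wpM2l// lerB.
have Wi : mu.-integrable `[a, b] (EFin \o W).
  apply: (bounded_measurable_integrable _ (M := M)) => //.
  - exact: lebesgue_itvcc_lty.
  - exact: lipschitz_itvcc_measurable WL.
  - by move=> t /= tab; rewrite ger0_norm ?W0// WM.
have fwd r : r \in `[a, b] ->
    \int[mu]_(t in `[a, r]) g t + W r <= K * \int[mu]_(t in `[a, r]) W t.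
  rewrite in_itv/= => /andP[ar rb].
  have := tail_integral_sub qi Wq (lexx a) ar rb; rewrite Wa => qW0.
  have gri : mu.-integrable `[a, r] (EFin \o g) by exact: integrable_itvccS gi.
  have Wri : mu.-integrable `[a, r] (EFin \o W) by exact: integrable_itvccS Wi.
  rewrite -RintegralZl//.
  have : \int[mu]_(t in `[a, r]) (g t - K * W t) <= \int[mu]_(t in `[a, r]) q t.
    apply: le_Rintegral => //.
    - by apply: integrable_EFinB => //; exact: integrable_EFinZl.
    - exact: integrable_itvccS qi.
    - move=> t /=; rewrite in_itv/= => /andP[at_ tr].
      have tab : t \in `[a, b] by rewrite in_itv/= at_ (le_trans tr).
      by rewrite -{1}(ger0_norm (W0 _ tab)); exact: gq.
  rewrite RintegralB//; last exact: integrable_EFinZl.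
  by lra.
have W_le n r : r \in `[a, b] -> W r <= M / 2 ^+ n * expR (2 * K * (r - a)).
  have M0 : 0 <= M by rewrite mulr_ge0// subr_ge0.
  elim: n r => [|n IH] r rab.
    apply: le_trans (WM _ rab) _; rewrite expr0 divr1 ler_peMr//.
    rewrite -[leLHS]expR0 ler_expR mulr_ge0// ?mulr_ge0 ?(ltW K0)// subr_ge0.
    by move: rab; rewrite in_itv/= => /andP[].
  have gr0 : 0 <= \int[mu]_(t in `[a, r]) g t.
    apply: Rintegral_ge0 => t /=; rewrite in_itv/= => /andP[at_ tr]; apply: g0.
    by move: rab; rewrite !in_itv/= at_ => /andP[_]; exact: le_trans.
  have ar : a <= r by move: rab; rewrite in_itv/= => /andP[].
  have rb : r <= b by move: rab; rewrite in_itv/= => /andP[].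
  have := fwd r rab.
  have : K * \int[mu]_(t in `[a, r]) W t
      <= M / 2 ^+ n.+1 * \int[mu]_(t in `[a, r]) (2 * K * expR (2 * K * (t - a))).
    have oi : mu.-integrable `[a, r] (EFin \o cst 1).
      apply: (bounded_measurable_integrable _ (M := 1)) => //.
        exact: lebesgue_itvcc_lty.
      by move=> t _; rewrite normr1.
    have ei : mu.-integrable `[a, r] (EFin \o (fun t => 2 * K * expR (2 * K * (t - a)))).
      apply: integrable_EFinZl => //.
      rewrite (_ : (fun t => _) = fun t => expR (2 * K * (t - a)) * cst 1 t).
        by apply: integrable_expR_weight => //; rewrite mulr_ge0// ltW.
      by apply/funext => t; rewrite mulr1.
    have Wri : mu.-integrable `[a, r] (EFin \o W) by exact: integrable_itvccS Wi.
    rewrite -!RintegralZl//; apply: le_Rintegral => //.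
    - exact: integrable_EFinZl.
    - exact: integrable_EFinZl.
    - move=> t /=; rewrite in_itv/= => /andP[at_ tr].
      have tab : t \in `[a, b] by rewrite in_itv/= at_ (le_trans tr).
      have := ler_wpM2l (ltW K0) (IH t tab).
      by rewrite exprS invfM; lra.
  rewrite Rintegral_expR// subrr mulr0 expR0.
  have : 0 <= M / 2 ^+ n.+1 by rewrite divr_ge0// exprn_ge0.
  move=> c0 h1 h2; apply: le_trans (le_trans _ h2) (le_trans h1 _).
    by rewrite lerDr.
  by rewrite ler_wpM2l// gerBl.
have {W_le}W_eq0 r : r \in `[a, b] -> W r = 0.
  move=> rab; apply/eqP; rewrite eq_le W0// andbT.
  apply: (@halving_le0 _ _ (M * expR (2 * K * (r - a)))) => n.
  by rewrite mulrAC W_le.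
apply/negP; rewrite -leNgt.
have bab : b \in `[a, b] by rewrite in_itv/= lexx ab.
have := fwd b bab; rewrite W_eq0// addr0 => /le_trans; apply.
have -> : \int[mu]_(t in `[a, b]) W t = \int[mu]_(t in `[a, b]) 0.
  by apply: eq_Rintegral => t; rewrite inE/= => /W_eq0.
by rewrite Rintegral_itvcc_cst// mul0r mulr0.
Qed.

End tail_integral_gt0.

(** * Backward equations with a Lipschitz field *)

Section backward_equation.
Context (R : realType).
Notation mu := (@lebesgue_measure R).
Implicit Types (T K M : R) (F G : R -> R -> R) (U V : R -> R).

Definition lipschitz_field T K M F : Prop :=
  [/\ forall u, measurable_fun `[0, T] (F^~ u),
      forall s u v, s \in `[0, T] -> `|F s u - F s v| <= K * `|u - v| &
      forall s, s \in `[0, T] -> `|F s 0| <= M].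

(** The equation of [solution], with the path [Y] absorbed in the field
    [F s u = f s (Y s) u]. *)
Definition solves T F U : Prop :=
  mu.-integrable `[0, T] (fun s => (F s (U s))%:E) /\
  forall t, t \in `[0, T] -> U t = \int[mu]_(s in `[t, T]) F s (U s).

Lemma lipschitz_continuous (h : R -> R) K x :
  (forall y, `|h x - h y| <= K * `|x - y|) -> {for x, continuous h}.
Proof.
move=> hK; apply/cvgrPdist_lt => e e0.
have K0 : 0 < `|K| + 1 by rewrite ltr_wpDl.
have /cvgrPdist_lt/(_ (e / (`|K| + 1))) := @cvg_id _ (nbhs x).
rewrite divr_gt0// => /(_ isT); apply: filterS => y.
rewrite ltr_pdivlMr// => h1; apply: le_lt_trans h1.
apply: le_trans (hK _) _; rewrite mulrC ler_wpM2l//.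
by rewrite (le_trans (ler_norm K))// lerDl.
Qed.

Lemma lipschitz_field_measurable T K M F V : lipschitz_field T K M F ->
  measurable_fun `[0, T] V -> measurable_fun `[0, T] (fun s => F s (V s)).
Proof.
move=> [mF FK _] mV; apply: measurable_fun_caratheodory => // s /= sT.
by apply: cvg_at_right_filter; apply: lipschitz_continuous => y; exact: FK.
Qed.

Lemma lipschitz_field_bound T K M F s u : lipschitz_field T K M F ->
  s \in `[0, T] -> `|F s u| <= M + K * `|u|.
Proof.
move=> [_ FK FM] sT; rewrite -[F s u](subrK (F s 0)) addrC.
rewrite (le_trans (ler_normD _ _))// lerD// ?FM//.
by have := FK s u 0 sT; rewrite subr0.
Qed.

Lemma lipschitz_field_integrable T K M F V (B : R) : 0 <= K ->
  lipschitz_field T K M F -> measurable_fun `[0, T] V ->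
  (forall s, s \in `[0, T] -> `|V s| <= B) ->
  mu.-integrable `[0, T] (EFin \o (fun s => F s (V s))).
Proof.
move=> K0 FL mV VB.
apply: (bounded_measurable_integrable _ (M := M + K * B)) => //.
- exact: lebesgue_itvcc_lty.
- exact: lipschitz_field_measurable FL mV.
- move=> s /= sT; apply: le_trans (lipschitz_field_bound _ FL sT) _.
  by rewrite lerD2l ler_wpM2l// VB.
Qed.

(** A solution is bounded by the integral of the modulus of its own integrand,
    which makes the integrand bounded by the Lipschitz condition. *)
Lemma solves_bounded T K M F U : 0 <= K -> lipschitz_field T K M F ->
  solves T F U -> exists B : R, (forall s, s \in `[0, T] -> `|U s| <= B) /\
    (forall s, s \in `[0, T] -> `|F s (U s)| <= B).
Proof.
move=> K0 FL [Fi UF].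
pose B0 := \int[mu]_(s in `[0, T]) `|F s (U s)|.
have UB t : t \in `[0, T] -> `|U t| <= B0.
  move=> tT; rewrite UF//; move: tT; rewrite in_itv/= => /andP[t0 tT].
  have Fti : mu.-integrable `[t, T] (EFin \o (fun s => F s (U s))).
    exact: integrable_itvccS Fi.
  apply: le_trans (le_normr_Rintegral _ Fti) _ => //.
  apply: ge0_subset_Rintegral => //.
    by apply: subset_itv; rewrite bnd_simp.
  exact: integrable_norm.
exists (Num.max B0 (M + K * B0)); split => s sT; rewrite le_max ?UB//.
apply/orP; right; apply: le_trans (lipschitz_field_bound _ FL sT) _.
by rewrite lerD2l ler_wpM2l// UB.
Qed.

Lemma solves_measurable T K M F U : 0 <= K -> lipschitz_field T K M F ->
  solves T F U -> measurable_fun `[0, T] U.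
Proof.
move=> K0 FL FU; have [B [_ FB]] := solves_bounded K0 FL FU.
apply: lipschitz_itvcc_measurable.
exact: (tail_integral_lipschitz FU.1 FB FU.2).
Qed.

(** The difference of the solutions for [F] and [G] is driven by the defect of
    [U] in the equation for [G], the rest being absorbed by the Lipschitz
    constant of [G]. *)
Lemma solves_stability T K M F G U V : 0 < K ->
  lipschitz_field T K M F -> lipschitz_field T K M G ->
  solves T F U -> solves T G V ->
  forall s, s \in `[0, T] -> `|U s - V s| <=
    \int[mu]_(t in `[s, T])
      (expR (2 * K * t) * `|F t (U t) - G t (U t)|).
Proof.
move=> K0 FL GL FU GV s sT.
have [B [UB FB]] := solves_bounded (ltW K0) FL FU.
have [B' [VB' GB']] := solves_bounded (ltW K0) GL GV.
have mU := solves_measurable (ltW K0) FL FU.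
have mV := solves_measurable (ltW K0) GL GV.
have GUi := lipschitz_field_integrable (ltW K0) GL mU UB.
have [[Fi UF] [Gi VG]] := (FU, GV).
pose d t : R := `|U t - V t|.
pose g t : R := `|F t (U t) - G t (U t)|.
have di : mu.-integrable `[0, T] (EFin \o d).
  apply: (bounded_measurable_integrable _ (M := B + B')) => //.
  - exact: lebesgue_itvcc_lty.
  - by apply: measurableT_comp => //; exact: measurable_funB.
  - move=> t /= tT; rewrite normr_id (le_trans (ler_normB _ _))//.
    by rewrite lerD ?UB ?VB'.
have gi : mu.-integrable `[0, T] (EFin \o g).
  by apply: integrable_norm; exact: integrable_EFinB.
have s0 : 0 <= s by move: sT; rewrite in_itv/= => /andP[].
have d0 t : t \in `[0, T] -> 0 <= d t by rewrite normr_ge0.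
have g0 t : t \in `[0, T] -> 0 <= g t by rewrite normr_ge0.
apply: le_trans (@gronwall _ 0 T K d g K0 di gi d0 g0 _ s sT) _.
  move=> {sT s0}s /[dup] sT; rewrite in_itv/= => /andP[s0 sT'].
  have sub (h : R -> R) : mu.-integrable `[0, T] (EFin \o h) ->
    mu.-integrable `[s, T] (EFin \o h) by exact: integrable_itvccS.
  have dgi : mu.-integrable `[s, T] (EFin \o (fun t => g t + K * d t)).
    by apply: integrable_EFinD; rewrite ?integrable_EFinZl ?sub.
  rewrite /d UF// VG// -RintegralB//; last 2 first.
  - exact: sub.
  - exact: sub.
  apply: le_trans (le_normr_Rintegral _ _) _ => //.
    by apply: integrable_EFinB => //; exact: sub.
  apply: le_Rintegral => //.
    by apply: integrable_norm; apply: integrable_EFinB => //; exact: sub.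
  move=> t /=; rewrite in_itv/= => /andP[st tT].
  have tT' : t \in `[0, T] by rewrite in_itv/= (le_trans s0).
  rewrite -(subrK (G t (U t)) (F t (U t))) -addrA.
  rewrite (le_trans (ler_normD _ _))// lerD2l.
  by case: GL => _ + _; apply.
have gsi : mu.-integrable `[s, T] (EFin \o g) by exact: integrable_itvccS gi.
apply: le_Rintegral => //.
- by apply: integrable_expR_weight => //; rewrite mulr_ge0// ltW.
- rewrite (_ : (fun t => expR (2 * K * t) * g t) =
               (fun t => expR (2 * K * (t - 0)) * g t)).
    by apply: integrable_expR_weight => //; rewrite mulr_ge0// ltW.
  by apply/funext => t; rewrite subr0.
- move=> t _; apply: ler_wpM2r; first exact: normr_ge0.
  by rewrite ler_expR ler_wpM2l ?gerBl// mulr_ge0// ltW.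
Qed.

Lemma solves_unique T K M F U V : 0 < K -> lipschitz_field T K M F ->
  solves T F U -> solves T F V -> {in `[0, T], V =1 U}.
Proof.
move=> K0 FL FU FV s sT; apply/esym/eqP; rewrite -subr_eq0 -normr_le0.
apply: le_trans (solves_stability K0 FL FL FU FV sT) _.
have -> : \int[mu]_(t in `[s, T]) (expR (2 * K * t) * `|F t (U t) - F t (U t)|)
    = \int[mu]_(t in `[s, T]) 0.
  by apply: eq_Rintegral => t _; rewrite subrr normr0 mulr0.
rewrite Rintegral_itvcc_cst ?mul0r//.
by move: sT; rewrite in_itv/= => /andP[].
Qed.

End backward_equation.

Section backward_existence.
Context (R : realType).
Notation mu := (@lebesgue_measure R).
Implicit Types (T K M : R) (F : R -> R -> R) (U V : R -> R).

Definition picard T F V (t : R) : R := \int[mu]_(s in `[t, T]) F s (V s).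

Lemma picard_measurable T K M F V (B : R) : 0 <= K -> lipschitz_field T K M F ->
  measurable_fun `[0, T] V -> (forall s, s \in `[0, T] -> `|V s| <= B) ->
  measurable_fun `[0, T] (picard T F V) /\
  exists B' : R, forall s, s \in `[0, T] -> `|picard T F V s| <= B'.
Proof.
move=> K0 FL mV VB.
have Fi := lipschitz_field_integrable K0 FL mV VB.
have FB s : s \in `[0, T] -> `|F s (V s)| <= M + K * B.
  move=> sT; apply: le_trans (lipschitz_field_bound _ FL sT) _.
  by rewrite lerD2l ler_wpM2l// VB.
have PL := @tail_integral_lipschitz _ 0 T _ (picard T F V) _ Fi FB (fun _ _ => erefl).
split; first exact: lipschitz_itvcc_measurable PL.
exists ((M + K * B) * T) => s /[dup] sT; rewrite in_itv/= => /andP[s0 sT'].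
have MB0 : 0 <= M + K * B by apply: le_trans (FB s sT).
apply: le_trans (normr_Rintegral_itvcc_le sT' _ _) _.
- exact: integrable_itvccS Fi.
- move=> t; rewrite in_itv/= => /andP[st tT]; apply: FB.
  by rewrite in_itv/= (le_trans s0).
- by rewrite ler_wpM2l// gerBl.
Qed.

(** [K] times the integral of the weight over [[t, T]] is at most half of the
    weight at [t]. *)
Lemma picard_contraction T K M F U V (B A : R) : 0 < K ->
  lipschitz_field T K M F ->
  measurable_fun `[0, T] U -> (forall s, s \in `[0, T] -> `|U s| <= B) ->
  measurable_fun `[0, T] V -> (forall s, s \in `[0, T] -> `|V s| <= B) ->
  (forall s, s \in `[0, T] -> `|U s - V s| <= A * expR (2 * K * (T - s))) ->
  forall t, t \in `[0, T] ->
    `|picard T F U t - picard T F V t| <= A / 2 * expR (2 * K * (T - t)).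
Proof.
move=> K0 FL mU UB mV VB UV t /[dup] tT; rewrite in_itv/= => /andP[t0 tT'].
have FUi := lipschitz_field_integrable (ltW K0) FL mU UB.
have FVi := lipschitz_field_integrable (ltW K0) FL mV VB.
have sub (h : R -> R) : mu.-integrable `[0, T] (EFin \o h) ->
  mu.-integrable `[t, T] (EFin \o h) by exact: integrable_itvccS.
have A0 : 0 <= A.
  have := le_trans (normr_ge0 _) (UV t tT).
  by rewrite pmulr_lge0// expR_gt0.
pose w (s : R) : R := - (2 * K) * expR (- (2 * K) * (s - T)).
have oi : mu.-integrable `[t, T] (EFin \o cst 1).
  apply: (bounded_measurable_integrable _ (M := 1)) => //.
    exact: lebesgue_itvcc_lty.
  by move=> s _; rewrite normr1.
have wi : mu.-integrable `[t, T] (EFin \o w).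
  apply: (bounded_measurable_integrable _ (M := 2 * K * expR (2 * K * (T - t)))) => //.
  - exact: lebesgue_itvcc_lty.
  - apply: subspace_continuous_measurable_fun => //.
    apply: continuous_subspaceT => s; apply: cvgM; first exact: cvg_cst.
    apply: continuous_comp; last exact: continuous_expR.
    by apply: cvgM; [exact: cvg_cst|apply: cvgB; [exact: cvg_id|exact: cvg_cst]].
  - move=> s /=; rewrite in_itv/= => /andP[ts sT].
    have K2 : 0 <= 2 * K by rewrite mulr_ge0// ltW.
    rewrite /w normrM normrN (ger0_norm K2) ger0_norm ?expR_ge0//.
    by rewrite ler_wpM2l// ler_expR mulNr -mulrN opprB ler_wpM2l// lerB.
rewrite /picard -RintegralB//; last 2 first.
- exact: sub.
- exact: sub.
apply: le_trans (le_normr_Rintegral _ _) _ => //.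
  by apply: integrable_EFinB => //; exact: sub.
apply: le_trans (_ : \int[mu]_(s in `[t, T]) (- (A / 2) * w s) <= _).
  apply: le_Rintegral => //.
  - by apply: integrable_norm; apply: integrable_EFinB => //; exact: sub.
  - exact: integrable_EFinZl.
  - move=> s /=; rewrite in_itv/= => /andP[ts sT].
    have sT' : s \in `[0, T] by rewrite in_itv/= (le_trans t0).
    have [_ FK _] := FL; apply: le_trans (FK s _ _ sT') _.
    apply: le_trans (ler_wpM2l (ltW K0) (UV s sT')) _.
    rewrite /w (_ : - (2 * K) * (s - T) = 2 * K * (T - s)); last by lra.
    by move: (expR _) => e; lra.
rewrite RintegralZl// /w Rintegral_expR// subrr mulr0 expR0.
rewrite mulNr -mulrN opprB ler_wpM2l ?divr_ge0//.
rewrite (_ : - (2 * K) * (t - T) = 2 * K * (T - t)); last by lra.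
by rewrite gerBl.
Qed.

(** Picard iterates form a Cauchy sequence of ratio 1/2 in the supremum norm
    weighted by [expR (2 K (T - t))]. *)
Lemma solves_exists T K M F : 0 <= T -> 0 < K -> lipschitz_field T K M F ->
  exists U, solves T F U.
Proof.
move=> T0 K0 FL.
have K2 : 0 <= 2 * K by rewrite mulr_ge0// ltW.
pose u n := iter n (picard T F) (cst 0).
have u_ok n : measurable_fun `[0, T] (u n) /\
    exists B : R, forall s, s \in `[0, T] -> `|u n s| <= B.
  elim: n => [|n [mu_n [B uB]]].
    split; first exact: measurable_cst.
    by exists 0 => s _; rewrite normr0.
  exact: picard_measurable (ltW K0) FL mu_n uB.
have [B1 uB1] := (u_ok 1%N).2.
have uS n t : t \in `[0, T] ->
    `|u n.+1 t - u n t| <= B1 / 2 ^+ n * expR (2 * K * (T - t)).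
  elim: n t => [|n IH] t tT.
    rewrite subr0 expr0 divr1; apply: le_trans (uB1 _ tT) _.
    have B10 := le_trans (normr_ge0 _) (uB1 _ tT).
    rewrite ler_peMr// -[leLHS]expR0 ler_expR mulr_ge0// subr_ge0.
    by move: tT; rewrite in_itv/= => /andP[].
  have [mu1 [Ba uBa]] := u_ok n.+1; have [mu0 [Bb uBb]] := u_ok n.
  rewrite exprSr invfM mulrA.
  apply: (@picard_contraction _ _ _ _ (u n.+1) (u n) (Num.max Ba Bb)) => //.
  - exact: FL.
  - by move=> s sT; rewrite le_max uBa.
  - by move=> s sT; rewrite le_max uBb// orbT.
pose C := B1 * expR (2 * K * T).
have B10 : 0 <= B1.
  by apply: le_trans (uB1 0 _); rewrite ?normr_ge0// in_itv/= lexx.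
have uC t : t \in `[0, T] -> forall n, `|u n.+1 t - u n t| <= C / 2 ^+ n.
  move=> tT n; apply: le_trans (uS n t tT) _.
  rewrite /C mulrAC ler_wpM2r ?invr_ge0 ?exprn_ge0// ler_wpM2l// ler_expR.
  rewrite ler_wpM2l// gerBl.
  by move: tT; rewrite in_itv/= => /andP[].
have limP t : exists l, t \in `[0, T] -> forall n, `|l - u n t| <= 2 * C / 2 ^+ n.
  have [tT|tT] := boolP (t \in `[0, T]).
    by have [l lP] := halving_limit (uC t tT); exists l.
  by exists 0.
have [U UP] := choice limP.
have C0 : 0 <= 2 * C by rewrite mulr_ge0// mulr_ge0// expR_ge0.
have mU : measurable_fun `[0, T] U.
  apply: (@measurable_fun_cvg _ _ _ _ u) => [n|t /= tT]; first exact: (u_ok n).1.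
  apply/cvgrPdist_le => e e0.
  exists (Num.trunc (2 * C / e)).+1 => // n /= ne.
  apply: le_trans (UP t tT n) _.
  rewrite ler_pdivrMr ?exprn_gt0// [leRHS]mulrC -ler_pdivrMr//.
  apply: le_trans (ltW (truncnS_gt _)) _; rewrite -natrX ler_nat.
  by apply: leq_trans ne (ltnW _); exact: ltn_expl.
have UB t : t \in `[0, T] -> `|U t| <= 2 * C.
  by move=> tT; have := UP t tT 0%N; rewrite subr0 expr0 divr1.
have FUi := lipschitz_field_integrable (ltW K0) FL mU UB.
exists U; split => // t /[dup] tT; rewrite in_itv/= => /andP[t0 tT'].
apply/eqP; rewrite -subr_eq0 -normr_le0.
apply: (@halving_le0 _ _ (2 * C + K * (2 * C) * T)) => n.
have [mun [B uB]] := u_ok n.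
have Fui := lipschitz_field_integrable (ltW K0) FL mun uB.
rewrite -(subrK (u n.+1 t) (U t)) -addrA mulrDl.
apply: le_trans (ler_normD _ _) _; apply: lerD.
  apply: le_trans (UP t tT n.+1) _.
  by rewrite ler_wpM2l// lef_pV2 ?posrE ?exprn_gt0// ler_weXn2l ?ler1n.
rewrite [u n.+1 t]/(\int[mu]_(s in `[t, T]) F s (u n s)).
have FunUi : mu.-integrable `[t, T] (EFin \o (fun s => F s (u n s) - F s (U s))).
  by apply: integrable_itvccS (integrable_EFinB _ Fui FUi).
rewrite -RintegralB//; last 2 first.
- exact: integrable_itvccS Fui.
- exact: integrable_itvccS FUi.
apply: le_trans (normr_Rintegral_itvcc_le (M := K * (2 * C) / 2 ^+ n) tT' FunUi _) _.
  move=> s; rewrite in_itv/= => /andP[ts sT].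
  have sT' : s \in `[0, T] by rewrite in_itv/= (le_trans t0).
  have [_ FK _] := FL; apply: le_trans (FK s _ _ sT') _.
  by rewrite -mulrA ler_wpM2l ?(ltW K0)// distrC UP.
rewrite [leRHS]mulrAC ler_wpM2l ?gerBl//.
by rewrite divr_ge0 ?exprn_ge0// mulr_ge0// ltW.
Qed.

(** The difference [W] of the solution and of a subsolution is the tail integral
    of a function that is at least the defect minus [K |W|]. *)
Lemma solves_comparison T K M F U Z (z : R -> R) (B : R) : 0 <= T -> 0 < K ->
  lipschitz_field T K M F -> solves T F U ->
  measurable_fun `[0, T] z -> (forall s, s \in `[0, T] -> `|z s| <= B) ->
  (forall t, t \in `[0, T] -> Z t = \int[mu]_(s in `[t, T]) z s) ->
  (forall s, s \in `[0, T] -> z s <= F s (Z s)) ->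
  (forall t, t \in `[0, T] -> Z t <= U t) /\
  forall x y, 0 <= x -> x < y -> y <= T ->
    (forall s, s \in `]x, y[ -> z s < F s (Z s)) -> Z 0 < U 0.
Proof.
move=> T0 K0 FL FU mz zB Zz zF.
have [BU [UB FB]] := solves_bounded (ltW K0) FL FU.
have zi : mu.-integrable `[0, T] (EFin \o z).
  apply: (bounded_measurable_integrable _ (M := B)) => //.
  exact: lebesgue_itvcc_lty.
have ZL := tail_integral_lipschitz zi zB Zz.
have mZ := lipschitz_itvcc_measurable ZL.
have TT : T \in `[0, T] by rewrite in_itv/= lexx T0.
have ZT : Z T = 0 by rewrite Zz// set_itv1 Rintegral_set1.
have ZB t : t \in `[0, T] -> `|Z t| <= B * T.
  move=> /[dup] tT; rewrite in_itv/= => /andP[t0 tT'].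
  rewrite -(subr0 (Z t)) -ZT; apply: le_trans (ZL _ _ tT TT) _.
  rewrite distrC ger0_norm ?subr_ge0// ler_wpM2l ?gerBl//.
  by apply: le_trans (zB _ tT).
have FZi := lipschitz_field_integrable (ltW K0) FL mZ ZB.
have [FUi UF] := FU.
pose q s := F s (U s) - z s.
pose W s := U s - Z s.
pose g s := F s (Z s) - z s.
have qi : mu.-integrable `[0, T] (EFin \o q) by exact: integrable_EFinB.
have gi : mu.-integrable `[0, T] (EFin \o g) by exact: integrable_EFinB.
have qB s : s \in `[0, T] -> `|q s| <= BU + B.
  by move=> sT; rewrite (le_trans (ler_normB _ _))// lerD ?FB ?zB.
have Wq t : t \in `[0, T] -> W t = \int[mu]_(s in `[t, T]) q s.
  move=> /[dup] tT; rewrite in_itv/= => /andP[t0 tT'].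
  rewrite /W UF// Zz// -RintegralB//.
  - exact: integrable_itvccS FUi.
  - exact: integrable_itvccS zi.
have gq s : s \in `[0, T] -> g s - K * `|W s| <= q s.
  move=> sT; have [_ FK _] := FL; have := FK s (Z s) (U s) sT.
  by rewrite /g /q /W (distrC (U s)) => /ler_normlW ?; lra.
have g0 s : s \in `[0, T] -> 0 <= g s by move=> sT; rewrite subr_ge0 zF.
split=> [t tT|x y x0 xy yT gpos].
  rewrite -subr_ge0; apply: (tail_integral_ge0 K0 qi qB Wq) => // s sT.
  by apply: le_trans (gq s sT); rewrite lerBrDr addNr g0.
rewrite -subr_gt0; apply: (tail_integral_gt0 K0 T0 qi qB Wq gi g0 gq).
by apply: (Rintegral_itvcc_gt0 gi g0 x0 xy yT) => s /gpos; rewrite subr_gt0.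
Qed.

End backward_existence.

(** * The measure of a plan *)

Section plan_measure.
Context (R : realType) (T : R).
Implicit Types (C D : plan T) (h : R -> R).

Lemma dplan_itvoc C a b : a <= b -> dplan C `]a, b]%classic = (C b - C a)%:E.
Proof.
move=> ab; pose mu : {measure set (ocitv_type R) -> \bar R} := wlength C.
have muE := @measurable_mu_extE _ _ _ mu `]a, b]%classic (is_ocitv a b).
exact: (etrans muE (@wlength_itv_bnd _ C a b false false ab)).
Qed.

Lemma dplan_itvcc_lty C : (dplan C `[0%R, T]%classic < +oo)%E.
Proof.
have [T0|T0] := ltP T 0.
  by rewrite set_itv_ge ?measure0// bnd_simp -ltNge.
have T1 : -1 <= T by rewrite (le_trans _ T0)// lerN10.
apply: (@le_lt_trans _ _ (dplan C `](-1)%R, T]%classic)).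
  apply: le_measure; rewrite ?inE//.
  by apply: subset_itvr; rewrite bnd_simp ltrN10.
by rewrite dplan_itvoc// ltry.
Qed.

Definition plan_mass C : R := fine (dplan C `[0%R, T]%classic).

Lemma plan_mass_ge0 C : 0 <= plan_mass C.
Proof. exact: fine_ge0. Qed.

Lemma dplan_integrable C h (M : R) : measurable_fun `[0, T] h ->
  (forall s, s \in `[0, T] -> `|h s| <= M) ->
  (dplan C).-integrable `[0, T] (EFin \o h).
Proof.
move=> mh hM; apply: (bounded_measurable_integrable _ (M := M)) => //.
exact: dplan_itvcc_lty.
Qed.

Lemma normr_dplan_Rintegral_le C (A : set (measurableTypeR R)) h (M : R) : measurable A ->
  A `<=` `[0, T] -> measurable_fun `[0, T] h -> 0 <= M ->
  (forall s, A s -> `|h s| <= M) ->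
  `|\int[dplan C]_(s in A) h s| <= M * fine (dplan C A).
Proof.
move=> mA AT mh M0 hM.
have Aoo : (dplan C A < +oo)%E.
  by apply: le_lt_trans (dplan_itvcc_lty C); apply: le_measure; rewrite ?inE.
have hi : (dplan C).-integrable A (EFin \o h).
  apply: (bounded_measurable_integrable _ (M := M)) => //.
  exact: measurable_funS mh.
apply: (le_trans (le_normr_Rintegral mA hi)).
rewrite -(Rintegral_cst (dplan C) mA M); apply: le_Rintegral => //.
  exact: integrable_norm.
apply: (bounded_measurable_integrable _ (M := M)) => // s _.
by rewrite ger0_norm.
Qed.

(** Both sides are measures that agree on the half-open intervals. *)
Lemma dplan_mix (l : {i01 R}) C D (A : set (measurableTypeR R)) : measurable A ->
  dplan (plan_mix l C D) A =
  (l%:num%:E * dplan C A + (1 - l%:num)%:E * dplan D A)%E.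
Proof.
move=> mA.
have l0 : 0 <= l%:num :> R by [].
have l1 : 0 <= 1 - l%:num :> R by rewrite subr_ge0.
pose m1 := mscale (NngNum l0) (dplan C).
pose m2 := mscale (NngNum l1) (dplan D).
transitivity (measure_add m1 m2 A); last by rewrite measure_addE.
apply: lebesgue_stieltjes_measure_unique mA => _ [[a b] _ <-].
apply: etrans (esym (measure_addE m1 m2 _)).
have [ab|ba] := leP a b; last first.
  by rewrite /= set_itv_ge ?measure0 ?mule0 ?adde0// bnd_simp -leNgt ltW.
have mE (k : {nonneg R}) (E : plan T) :
    mscale k (dplan E) `]a, b]%classic = (k%:num * (E b - E a))%:E.
  by rewrite EFinM -(dplan_itvoc E ab).
apply: etrans (dplan_itvoc (plan_mix l C D) ab) _.
apply: etrans (esym (congr2 adde (mE _ C) (mE _ D))).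
by apply: (congr1 EFin) => /=; lra.
Qed.

Lemma Rintegral_dplan_mix (l : {i01 R}) C D (A : set (measurableTypeR R)) h (M : R) :
  measurable A -> A `<=` `[0, T] -> measurable_fun `[0, T] h ->
  (forall s, A s -> 0 <= h s) -> (forall s, A s -> `|h s| <= M) ->
  \int[dplan (plan_mix l C D)]_(s in A) h s =
  l%:num * \int[dplan C]_(s in A) h s
  + (1 - l%:num) * \int[dplan D]_(s in A) h s.
Proof.
move=> mA AT mh h0 hM.
have l0 : 0 <= l%:num :> R by [].
have l1 : 0 <= 1 - l%:num :> R by rewrite subr_ge0.
pose m1 := mscale (NngNum l0) (dplan C).
pose m2 := mscale (NngNum l1) (dplan D).
have mhA : measurable_fun A (EFin \o h).
  by apply/measurable_EFinP; exact: measurable_funS mh.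
have hi (E : plan T) : (dplan E).-integrable A (EFin \o h).
  apply: (bounded_measurable_integrable _ (M := M)) => //.
    by apply: le_lt_trans (dplan_itvcc_lty E); apply: le_measure; rewrite ?inE.
  exact: measurable_funS mh.
rewrite /Rintegral (eq_measure_integral (measure_add m1 m2)); last first.
  move=> B mB _.
  exact: etrans (dplan_mix l C D mB) (esym (measure_addE m1 m2 B)).
rewrite ge0_integral_measure_add//= !ge0_integral_mscale//=.
have fE (E : plan T) := integrable_fin_num mA (hi E).
rewrite fineD; last 2 first.
- by rewrite fin_numM// fE.
- by rewrite fin_numM// fE.
by congr (_ + _); exact: fineM (fE _).
Qed.

End plan_measure.

(** * The level of satisfaction *)

Section compact_continuity.
Context (R : realType).

Lemma within_compact_bounded (V : topologicalType) (K : set V) (h : V -> R) :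
  compact K -> {within K, continuous h} ->
  exists2 M : R, 0 <= M & forall x, K x -> `|h x| <= M.
Proof.
move=> cK ch; have /compact_bounded[M [_ hM]] := continuous_compact ch cK.
exists (`|M| + 1); first by rewrite addr_ge0.
move=> x Kx; apply: hM; last by exists x.
by rewrite (le_lt_trans (ler_norm M))// ltrDl.
Qed.

(** Heine's theorem on the square, in the form of a common modulus. *)
Lemma square_uniform_continuity (T : R) (theta : R -> R -> R) :
  {within `[0, T] `*` `[0, T], continuous (fun p : R * R => theta p.1 p.2)} ->
  forall e : R, 0 < e -> exists2 d : R, 0 < d &
    forall t s t' s', t \in `[0, T] -> s \in `[0, T] ->
      t' \in `[0, T] -> s' \in `[0, T] ->
      `|t - t'| < d -> `|s - s'| < d -> `|theta t s - theta t' s'| < e.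
Proof.
move=> ct e e0; set Q := `[0, T] `*` `[0, T].
have cQ : compact Q by apply: compact_setX; exact: segment_compact.
have /compact_near_coveringP/near_covering_withinP := cQ.
move=> /(_ R (0:R)^'+ (fun d p => forall t' s', t' \in `[0, T] ->
  s' \in `[0, T] -> `|p.1 - t'| < d -> `|p.2 - s'| < d ->
  `|theta p.1 p.2 - theta t' s'| < e)) near_d.
have {near_d} : \forall d \near (0:R)^'+, Q `<=` (fun p => forall t' s',
    t' \in `[0, T] -> s' \in `[0, T] -> `|p.1 - t'| < d -> `|p.2 - s'| < d ->
    `|theta p.1 p.2 - theta t' s'| < e).
  apply: near_d => -[t0 s0] Qp.
  have := (subspace_continuousP _ _).1 ct (t0, s0) Qp.
  move=> /cvgrPdist_lt/(_ (e / 2)); rewrite divr_gt0// => /(_ isT).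
  move=> /nbhs_ballP[r /= r0 rball]; have r2 : 0 < r / 2 by rewrite divr_gt0.
  exists (ball (t0, s0) (r / 2), [set d | d < r / 2]).
    by split; [exact: nbhsx_ballx|exact: nbhs_right_lt].
  move=> [[t s] d] /= [[/= tr sr] dr] Qts t' s' t'T s'T tt' ss'.
  have h1 : `|theta t0 s0 - theta t s| < e / 2.
    apply: (rball (t, s)) => //; split => /=.
      by apply: le_ball tr; rewrite ler_pdivrMr// ler_peMr// ?ler1n// ltW.
    by apply: le_ball sr; rewrite ler_pdivrMr// ler_peMr// ?ler1n// ltW.
  have h2 : `|theta t0 s0 - theta t' s'| < e / 2.
    apply: (rball (t', s')) => //; split => /=.
      by rewrite [r]splitr; apply: ball_triangle tr _; exact: lt_trans tt' dr.
    by rewrite [r]splitr; apply: ball_triangle sr _; exact: lt_trans ss' dr.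
  rewrite (le_lt_trans (ler_distD (theta t0 s0) _ _))// [e]splitr ltrD//.
  by rewrite distrC.
move=> near_d.
have [d [d0 hd]] : exists d : R, 0 < d /\ (Q `<=` (fun p => forall t' s',
    t' \in `[0, T] -> s' \in `[0, T] -> `|p.1 - t'| < d -> `|p.2 - s'| < d ->
    `|theta p.1 p.2 - theta t' s'| < e)).
  apply: (@filter_ex _ (0:R)^'+); near=> d; split.
    by near: d; exact: nbhs_right_gt.
  by near: d; exact: near_d.
by exists d => // t s t' s' tT sT; apply: (hd (t, s)).
Unshelve. all: by end_near. Qed.

End compact_continuity.

Section satisfaction_theory.
Context (R : realType) (T : R) (eta : R -> R) (theta : R -> R -> R).
Hypothesis eta_cont : {within `[0, T], continuous eta}.
Hypothesis eta_ge0 : forall t, t \in `[0, T] -> 0 <= eta t.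
Hypothesis theta_cont : {within `[0, T] `*` `[0, T],
  continuous (fun p : R * R => theta p.1 p.2)}.
Hypothesis theta_ge0 : forall t s, t \in `[0, T] -> s \in `[0, T] ->
  0 <= theta t s.
Notation Y := (@satisfaction R T eta theta).
Implicit Types (C D : plan T).

Let subT t : t \in `[0, T] -> `[0, t] `<=` (`[0, T] : set R).
Proof.
rewrite in_itv/= => /andP[_ tT].
by apply: subset_itvl; rewrite bnd_simp.
Qed.

Lemma theta_measurable t : t \in `[0, T] -> measurable_fun `[0, T] (theta t).
Proof.
move=> tT; apply: subspace_continuous_measurable_fun => //.
apply/subspace_continuousP => s /= sT; apply/cvgrPdist_lt => e e0.
have [d d0 hd] := square_uniform_continuity theta_cont e0.
apply: (filterS _ (nbhsx_ballx s d d0)) => s' ss' s'T.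
by apply: hd => //; rewrite subrr normr0.
Qed.

Lemma theta_bounded : exists2 M : R, 0 <= M &
  forall t s, t \in `[0, T] -> s \in `[0, T] -> `|theta t s| <= M.
Proof.
have cQ : compact (`[0, T] `*` `[0, T] : set (R * R)).
  by apply: compact_setX; exact: segment_compact.
have [M M0 hM] := within_compact_bounded cQ theta_cont.
by exists M => // t s tT sT; exact: (hM (t, s)).
Qed.

Lemma dplan_subset_le C (A : set (measurableTypeR R)) : measurable A ->
  A `<=` `[0, T] -> fine (dplan C A) <= plan_mass C.
Proof.
move=> mA AT; have le : (dplan C A <= dplan C `[0%R, T]%classic)%E.
  by apply: le_measure; rewrite ?inE.
apply: fine_le => //; rewrite ge0_fin_numE//; last exact: dplan_itvcc_lty.
exact: le_lt_trans le (dplan_itvcc_lty C).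
Qed.

Lemma satisfaction_ge0 C t : t \in `[0, T] -> 0 <= Y C t.
Proof.
move=> tT; rewrite addr_ge0 ?eta_ge0//; apply: Rintegral_ge0 => s sT.
by apply: theta_ge0 => //; exact: (subT tT).
Qed.

Lemma satisfaction_le : exists M : R, 0 <= M /\
  forall C t, t \in `[0, T] -> Y C t <= M * (1 + plan_mass C).
Proof.
have [M M0 hM] := theta_bounded.
have [M' M'0 hM'] := within_compact_bounded (@segment_compact _ 0 T) eta_cont.
exists (M' + M); split; first by rewrite addr_ge0.
move=> C t tT; have m0 := plan_mass_ge0 C.
rewrite mulrDl; apply: lerD.
  rewrite (le_trans (ler_norm _))// (le_trans (hM' _ _))//.
  by rewrite ler_peMr// lerDl.
apply: le_trans (ler_norm _) _.
have tA : measurable (`[0, t]%classic : set (measurableTypeR R)).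
  exact: measurable_itv.
apply: le_trans (normr_dplan_Rintegral_le C tA (subT tT) (theta_measurable tT) M0 _) _.
  by move=> s /(subT tT) sT; apply: hM.
apply: ler_wpM2l => //; apply: le_trans (dplan_subset_le C tA (subT tT)) _.
by rewrite lerDr.
Qed.

(** For [t < y], the integral over [[0, y]] differs from that over [[0, t]] by a
    perturbation of the integrand, which is uniformly small, and by an integral
    over an interval of mass [C y - C t].  The time is frozen after [T], where
    [theta] is arbitrary. *)
Lemma satisfaction_right_continuous C t : t \in `[0, T] ->
  Y C (Num.min y T) @[y --> t^'+] --> Y C t.
Proof.
move=> /[dup] tT; rewrite in_itv/= => /andP[t0 tT'].
have [tltT|Tlet] := ltP t T; last first.
  have -> : t = T by apply/eqP; rewrite eq_le tT' Tlet.
  apply: (@cvg_trans _ (Y C T @[y --> T^'+])); last exact: cvg_cst.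
  apply: near_eq_cvg; near=> y.
  rewrite (min_idPr _)// ltW//; near: y; exact: nbhs_right_gt.
have minE : \forall y \near t^'+, Num.min y T = y.
  by near=> y; apply/min_idPl/ltW; near: y; exact: nbhs_right_lt.
apply: cvgD.
  apply/cvgrPdist_lt => e e0.
  have := (subspace_continuousP _ _).1 eta_cont t tT.
  move=> /cvgrPdist_lt/(_ e e0) h.
  have {}h : \forall y \near t, `[0, T]%classic y -> `|eta t - eta y| < e := h.
  have {}h : \forall y \near t^'+, `[0, T]%classic y -> `|eta t - eta y| < e.
    by rewrite near_withinE; apply: filterS h => y h ?.
  near=> y; have -> : Num.min y T = y by near: y.
  have ty : t < y by near: y; exact: nbhs_right_gt.
  have yT : y < T by near: y; exact: nbhs_right_lt.
  have : `[0, T]%classic y by rewrite /= in_itv/= (le_trans t0 (ltW ty)) ltW.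
  by near: y.
apply/cvgrPdist_le => e e0.
have [M M0 hM] := theta_bounded.
have m0 := plan_mass_ge0 C.
have k0 : 0 < M + plan_mass C + 1 by rewrite ltr_wpDl// addr_ge0.
pose w := e / (M + plan_mass C + 1).
have w0 : 0 < w by rewrite divr_gt0.
have [d d0 hd] := square_uniform_continuity theta_cont w0.
have /cvgrPdist_lt/(_ w w0) rcC := @plan_right_continuous _ _ C t.
near=> y; have -> : Num.min y T = y by near: y.
have ty : t < y by near: y; exact: nbhs_right_gt.
have yT : y < T by near: y; exact: nbhs_right_lt.
have y0T : y \in `[0, T] by rewrite in_itv/= (le_trans t0 (ltW ty)) ltW.
have Cy : C y - C t < w.
  have : `|C t - C y| < w by near: y.
  by apply: le_lt_trans; rewrite [leRHS]distrC ler_norm.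
have tyd : `|t - y| < d.
  rewrite distrC gtr0_norm ?subr_gt0// ltrBlDl.
  by near: y; apply: nbhs_right_lt; rewrite ltrDl.
have mI (i : interval R) : measurable ([set` i] : set (measurableTypeR R)).
  exact: measurable_itv.
have ocT : `]t, y] `<=` (`[0, T] : set R).
  by apply: subset_itv; rewrite bnd_simp// ltW.
have yint : (dplan C).-integrable `[0, y] (EFin \o theta y).
  apply: integrableS (dplan_integrable C (theta_measurable y0T) _) => //; last first.
    by move=> s sT; exact: (hM y s).
  exact: (subT y0T).
have splity : \int[dplan C]_(s in `[0, y]) theta y s =
    \int[dplan C]_(s in `[0, t]) theta y s + \int[dplan C]_(s in `]t, y]) theta y s.
  rewrite (@itv_bndbnd_setU _ _ _ (BRight t)) ?bnd_simp ?(ltW ty)//.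
  rewrite Rintegral_setU//.
    by rewrite -itv_bndbnd_setU ?bnd_simp ?(ltW ty).
  apply/disj_setPS => s [/=]; rewrite !in_itv/= => /andP[_ st] /andP[ts _].
  by rewrite ltNge st in ts.
rewrite splity.
have ti u : u \in `[0, T] -> (dplan C).-integrable `[0, t] (EFin \o theta u).
  move=> uT; apply: integrableS (dplan_integrable C (theta_measurable uT) _) => //; last first.
    by move=> s sT; exact: (hM u s).
  exact: (subT tT).
rewrite opprD addrA -RintegralB//; [|exact: ti|exact: ti].
apply: le_trans (ler_normB _ _) _.
have h1 : `|\int[dplan C]_(s in `[0, t]) (theta t s - theta y s)|
    <= w * plan_mass C.
  apply: le_trans (normr_dplan_Rintegral_le C (mI `[0, t]) (subT tT) _ (ltW w0) _) _.
  - by apply: measurable_funB; exact: theta_measurable.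
  - move=> s /(subT tT) sT; apply/ltW/hd => //.
    by rewrite subrr normr0.
  - by rewrite ler_wpM2l ?(ltW w0)//; apply: dplan_subset_le => //; exact: subT.
have h2 : `|\int[dplan C]_(s in `]t, y]) theta y s| <= M * w.
  apply: le_trans (normr_dplan_Rintegral_le C (mI `]t, y]) ocT _ M0 _) _.
  - exact: theta_measurable.
  - by move=> s /ocT sT; exact: hM.
  - by rewrite ler_wpM2l// dplan_itvoc ?(ltW ty)//= ltW.
apply: le_trans (lerD h1 h2) _.
have -> : e = w * (M + plan_mass C + 1) by rewrite /w divfK// gt_eqF.
by rewrite mulrC -mulrDl mulrC ler_wpM2l ?(ltW w0)// addrC lerDl.
Unshelve. all: by end_near. Qed.

Lemma satisfaction_measurable C : measurable_fun `[0, T] (Y C).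
Proof.
have m : measurable_fun `[0, T] (fun t : R => Y C (Num.min t T)).
  apply: (@measurable_fun_caratheodory _ _ _ _ (fun _ y => Y C (Num.min y T))) => //.
  move=> t /= /[dup] tT; rewrite in_itv/= => /andP[_ tT'].
  by rewrite (min_idPl tT'); exact: satisfaction_right_continuous.
apply: eq_measurable_fun m => t; rewrite inE/= in_itv/= => /andP[_ tT].
by rewrite (min_idPl tT).
Qed.

Local Open Scope convex_scope.

Lemma satisfaction_conv (l : {i01 R}) C D t : t \in `[0, T] ->
  Y (C <| l |> D) t = l%:num * Y C t + (1 - l%:num) * Y D t.
Proof.
move=> tT; have [M M0 hM] := theta_bounded.
have affine (k x a b : R) :
    x + (k * a + (1 - k) * b) = k * (x + a) + (1 - k) * (x + b) by lra.
have mI : measurable (`[0, t]%classic : set (measurableTypeR R)).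
  exact: measurable_itv.
rewrite /satisfaction (Rintegral_dplan_mix l C D mI (subT tT) (theta_measurable tT) _ (M := M)).
- exact: affine.
- by move=> s /(subT tT) sT; exact: theta_ge0.
- by move=> s /(subT tT) sT; exact: hM.
Qed.

End satisfaction_theory.

(** * Weak convergence of plans *)

Section ramp.
Context (R : realType).
Implicit Types (a b s : R).

(** The piecewise linear cutoff between [a] and [b]. *)
Definition ramp a b s : R := Num.max 0 (Num.min 1 ((b - s) / (b - a))).

Lemma ramp_ge0 a b s : 0 <= ramp a b s.
Proof. by rewrite le_max lexx. Qed.

Lemma ramp_le1 a b s : ramp a b s <= 1.
Proof. by rewrite ge_max ler01 ge_min lexx. Qed.

Lemma ramp_eq1 a b s : a < b -> s <= a -> ramp a b s = 1.
Proof.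
move=> ab sa; have h : 1 <= (b - s) / (b - a).
  by rewrite ler_pdivlMr ?subr_gt0// mul1r lerB.
by rewrite /ramp (min_idPl h) (max_idPr ler01).
Qed.

Lemma ramp_eq0 a b s : a < b -> b <= s -> ramp a b s = 0.
Proof.
move=> ab bs; apply/max_idPl; rewrite ge_min; apply/orP; right.
by rewrite pmulr_lle0 ?invr_gt0 ?subr_gt0// subr_le0.
Qed.

Lemma ramp_continuous a b : continuous (ramp a b).
Proof.
move=> s.
apply: (@continuous_max _ _ (cst 0) (fun s => Num.min 1 ((b - s) / (b - a)))).
  exact: cvg_cst.
apply: (@continuous_min _ _ (cst 1) (fun s => (b - s) / (b - a))).
  exact: cvg_cst.
by apply: cvgM; [apply: cvgB; [exact: cvg_cst|exact: cvg_id]|exact: cvg_cst].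
Qed.

End ramp.

Section weak_topology.
Context (R : realType) (T : R).

Lemma test_integral_continuous (phi : R -> R) :
  {within `[0, T], continuous phi} ->
  continuous (fun C : plan T => \int[dplan C]_(t in `[0, T]) phi t).
Proof.
move=> cphi C; pose tphi : test_function T := exist _ phi cphi.
have c1 : continuous (@test_integrals R T) by exact: initial_continuous.
have c2 := @proj_continuous {classic test_function T} (fun _ => R : topologicalType) tphi.
exact: (continuous_comp (c1 C) (c2 _)).
Qed.

Lemma dplan_Rintegral_le_error (C : plan T) (h k : R -> R) (M N w : R)
    (A : set (measurableTypeR R)) :
  measurable_fun `[0, T] h -> (forall s, s \in `[0, T] -> `|h s| <= N) ->
  measurable_fun `[0, T] k -> (forall s, s \in `[0, T] -> `|k s| <= N) ->
  measurable A -> A `<=` `[0, T] ->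
  (forall s, s \in `[0, T] -> h s <= k s + (w + M * \1_A s)) ->
  \int[dplan C]_(s in `[0, T]) h s <=
  \int[dplan C]_(s in `[0, T]) k s + (w * plan_mass C + M * fine (dplan C A)).
Proof.
move=> mh hN mk kN mA AT hk.
have mT : measurable (`[0, T]%classic : set (measurableTypeR R)).
  exact: measurable_itv.
have hi := dplan_integrable C mh hN.
have ki := dplan_integrable C mk kN.
have m1 : measurable_fun `[0, T] (\1_A : measurableTypeR R -> R).
  exact: measurable_indic.
have i1 : (dplan C).-integrable `[0, T] (EFin \o (\1_A : measurableTypeR R -> R)).
  apply: (dplan_integrable C m1 (M := 1)) => s _.
  by rewrite indicE; case: (_ \in _); rewrite ?normr1 ?normr0.
have ci : (dplan C).-integrable `[0, T] (EFin \o cst w).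
  by apply: (dplan_integrable C _ (M := `|w|)).
have Mi := integrable_EFinZl mT M i1.
have wMi := integrable_EFinD mT ci Mi.
apply: le_trans (le_Rintegral mT hi (integrable_EFinD mT ki wMi) hk) _.
rewrite RintegralD// lerD2l RintegralD// lerD//.
  by rewrite Rintegral_cst.
rewrite RintegralZl// /Rintegral integral_indic//.
by rewrite setIidl.
Qed.

End weak_topology.

Section weak_convergence.
Context (R : realType) (T : R) (eta : R -> R) (theta : R -> R -> R).
Hypothesis theta_cont : {within `[0, T] `*` `[0, T],
  continuous (fun p : R * R => theta p.1 p.2)}.
Hypothesis theta_ge0 : forall t s, t \in `[0, T] -> s \in `[0, T] ->
  0 <= theta t s.
Notation Y := (@satisfaction R T eta theta).
Implicit Types (C D : plan T).

(** A continuous approximation of [s |-> theta t s] truncated at [t], for [t]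
    close to [a] and [b]. *)
Definition cutoff_kernel a b (s : R) : R := theta a s * ramp a b s.

Lemma cutoff_kernel_continuous a b : a \in `[0, T] ->
  {within `[0, T], continuous (cutoff_kernel a b)}.
Proof.
move=> aT; apply/subspace_continuousP => s /= sT; apply: cvgM.
  apply/cvgrPdist_lt => e e0.
  have [d d0 hd] := square_uniform_continuity theta_cont e0.
  apply: (filterS _ (nbhsx_ballx s d d0)) => s' ss' s'T.
  by apply: hd => //; rewrite subrr normr0.
by apply: cvg_within_filter; exact: ramp_continuous.
Qed.

Lemma cutoff_kernel_le a b s (M : R) : a \in `[0, T] -> s \in `[0, T] ->
  `|theta a s| <= M -> `|cutoff_kernel a b s| <= M.
Proof.
move=> aT sT; apply: le_trans; rewrite normrM ler_piMr//.
by rewrite ger0_norm ?ramp_ge0// ramp_le1.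
Qed.

Notation past_kernel t := (theta t \_ (`[0, t]%classic : set R)).

Lemma satisfactionE C t : t \in `[0, T] ->
  Y C t = eta t + \int[dplan C]_(s in `[0, T]) (past_kernel t) s.
Proof.
rewrite in_itv/= => /andP[_ tT]; rewrite /satisfaction; congr (_ + _).
rewrite -Rintegral_mkcondr; congr (Rintegral _ _ _).
by rewrite setIidr//; apply: subset_itvl; rewrite bnd_simp.
Qed.

Section error.
Variables (t a b w M : R).
Hypothesis ab : a < b.
Hypothesis tT : t \in `[0, T].
Hypothesis aT : a \in `[0, T].
Hypothesis bT : b \in `[0, T].
Hypothesis M0 : 0 <= M.
Hypothesis w0 : 0 <= w.
Hypothesis hM : forall t s, t \in `[0, T] -> s \in `[0, T] -> `|theta t s| <= M.
Hypothesis tw : forall s, s \in `[0, T] -> `|theta t s - theta a s| <= w.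

Let pastE s : s \in `[0, T] -> past_kernel t s = if s <= t then theta t s else 0.
Proof.
rewrite in_itv/= => /andP[s0 _]; rewrite patchE.
case: ifPn => st; case: ifPn => // st'.
- by move: st; rewrite inE/= in_itv/= (negbTE st') andbF.
- by move: st; rewrite notin_setE/= in_itv/= s0 st'.
Qed.

Let mpast : measurable_fun `[0, T] (past_kernel t).
Proof.
apply/measurable_restrict => //.
by apply: measurable_funS (theta_measurable theta_cont tT).
Qed.

Let past_le s : s \in `[0, T] -> `|past_kernel t s| <= M.
Proof. by move=> sT; rewrite pastE//; case: ifP; rewrite ?hM ?normr0. Qed.

Let mcutoff : measurable_fun `[0, T] (cutoff_kernel a b).
Proof.
apply: subspace_continuous_measurable_fun => //.
exact: cutoff_kernel_continuous.
Qed.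

Let cutoff_le s : s \in `[0, T] -> `|cutoff_kernel a b s| <= M.
Proof. by move=> sT; apply: cutoff_kernel_le => //; exact: hM. Qed.

Let mI (i : interval R) : measurable ([set` i] : set (measurableTypeR R)).
Proof. exact: measurable_itv. Qed.

Let ocT x y : x \in `[0, T] -> y \in `[0, T] -> `]x, y] `<=` (`[0, T] : set R).
Proof.
rewrite !in_itv/= => /andP[x0 _] /andP[_ yT].
by apply: subset_itv; rewrite bnd_simp.
Qed.

Local Notation I C h := (\int[dplan C]_(s in `[0, T]) (h : R -> R) s).

Let error0 C (h k : R -> R) :
  measurable_fun `[0, T] h -> (forall s, s \in `[0, T] -> `|h s| <= M) ->
  measurable_fun `[0, T] k -> (forall s, s \in `[0, T] -> `|k s| <= M) ->
  (forall s, s \in `[0, T] -> h s <= k s + w) ->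
  I C h <= I C k + w * plan_mass C.
Proof.
move=> mh hN mk kN hk.
have := @dplan_Rintegral_le_error R T C h k 0 M w set0 mh hN mk kN.
rewrite mul0r addr0; apply => // s sT.
by rewrite mul0r addr0 hk.
Qed.

Let error1 C x y (h k : R -> R) : x \in `[0, T] -> y \in `[0, T] -> x <= y ->
  measurable_fun `[0, T] h -> (forall s, s \in `[0, T] -> `|h s| <= M) ->
  measurable_fun `[0, T] k -> (forall s, s \in `[0, T] -> `|k s| <= M) ->
  (forall s, s \in `[0, T] -> ~~ (x < s <= y) -> h s <= k s + w) ->
  (forall s, s \in `[0, T] -> x < s <= y -> h s <= k s + (w + M)) ->
  I C h <= I C k + (w * plan_mass C + M * (C y - C x)).
Proof.
move=> xT yT xy mh hN mk kN hk1 hk2.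
rewrite (_ : C y - C x = fine (dplan C `]x, y]%classic)); last first.
  by rewrite dplan_itvoc.
apply: (@dplan_Rintegral_le_error R T C h k M M w `]x, y]%classic mh hN mk kN
  (mI _) (ocT xT yT)) => s sT.
rewrite indicE; have [sxy|sxy] := boolP (s \in `]x, y]%classic).
  by rewrite mulr1 hk2//; move: sxy; rewrite inE/= in_itv.
by rewrite mulr0 addr0 hk1//; move: sxy; rewrite notin_setE/= in_itv/= => /negP.
Qed.

Let tw' s : s \in `[0, T] -> theta t s <= theta a s + w /\ theta a s <= theta t s + w.
Proof. by move=> /tw; rewrite ler_norml => /andP[? ?]; split; lra. Qed.

Let cutoff_ge0 s : s \in `[0, T] -> 0 <= cutoff_kernel a b s.
Proof. by move=> sT; rewrite mulr_ge0 ?ramp_ge0 ?theta_ge0. Qed.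

Let cutoff_le_theta s : s \in `[0, T] -> cutoff_kernel a b s <= theta a s.
Proof. by move=> sT; rewrite ler_piMr ?ramp_le1 ?theta_ge0. Qed.

Let past_ge0 s : s \in `[0, T] -> 0 <= past_kernel t s.
Proof. by move=> sT; rewrite pastE//; case: ifP => // _; exact: theta_ge0. Qed.

Let past_le_theta s : s \in `[0, T] -> past_kernel t s <= theta t s.
Proof. by move=> sT; rewrite pastE//; case: ifP => // _; exact: theta_ge0. Qed.

(** The four inequalities below squeeze the integral of the truncated kernel
    between integrals of continuous functions, a late cutoff [t <= a < b] from
    above and an early cutoff [a < b <= t] from below.  Two of them hold with an
    error [w * plan_mass C] for all plans; the two reverse ones cost in addition
    the mass of a neighbourhood of [t] and serve only for the limit plan. *)
Lemma past_le_late_cutoff C : t <= a ->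
  I C (past_kernel t) <= I C (cutoff_kernel a b) + w * plan_mass C.
Proof.
move=> ta; apply: error0 => // s sT; rewrite pastE//; case: ifPn => [st|_].
  rewrite /cutoff_kernel ramp_eq1 ?mulr1//; first by have [] := tw' sT.
  exact: le_trans ta.
by rewrite addr_ge0// cutoff_ge0.
Qed.

Lemma late_cutoff_le_past C : t <= a ->
  I C (cutoff_kernel a b) <=
  I C (past_kernel t) + (w * plan_mass C + M * (C b - C t)).
Proof.
move=> ta; apply: error1 => //; first exact: le_trans ta (ltW ab).
- move=> s sT; rewrite negb_and -leNgt -ltNge => /orP[st|bs].
    apply: le_trans (cutoff_le_theta sT) _; rewrite pastE// st.
    by have [] := tw' sT.
  by rewrite /cutoff_kernel ramp_eq0// ?mulr0 ?addr_ge0 ?past_ge0// ltW.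
- move=> s sT _; apply: le_trans (le_trans (ler_norm _) (cutoff_le sT)) _.
  by have := past_ge0 sT; have := w0; lra.
Qed.

Lemma early_cutoff_le_past C : b <= t ->
  I C (cutoff_kernel a b) <= I C (past_kernel t) + w * plan_mass C.
Proof.
move=> bt; apply: error0 => // s sT; have [sb|bs] := ltP s b; last first.
  by rewrite /cutoff_kernel ramp_eq0// mulr0 addr_ge0// past_ge0.
apply: le_trans (cutoff_le_theta sT) _; rewrite pastE// (le_trans (ltW sb) bt).
by have [] := tw' sT.
Qed.

Lemma past_le_early_cutoff C : b <= t ->
  I C (past_kernel t) <=
  I C (cutoff_kernel a b) + (w * plan_mass C + M * (C t - C a)).
Proof.
move=> bt; apply: error1 => //; first exact: le_trans (ltW ab) bt.
- move=> s sT; rewrite negb_and -leNgt -ltNge => /orP[sa|ts].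
    apply: le_trans (past_le_theta sT) _.
    by rewrite /cutoff_kernel ramp_eq1// mulr1; have [] := tw' sT.
  by rewrite pastE// [s <= t]leNgt ts addr_ge0// cutoff_ge0.
- move=> s sT _; apply: le_trans (le_trans (ler_norm _) (past_le sT)) _.
  by have := cutoff_ge0 sT; have := w0; lra.
Qed.

End error.
End weak_convergence.

Section sequential_continuity.
Context (R : realType).

(** Countably many continuous functionals [p k] cut out countably many
    neighbourhoods of [x]; if [J] were not continuous at [x], a bad point could
    be picked in each of them. *)
Lemma countable_test_continuous (X : topologicalType) (p : nat -> X -> R)
    (J : X -> R) (x : X) :
  (forall k, continuous (p k)) ->
  (forall u : nat -> X, (forall k, p k (u n) @[n --> \oo] --> p k x) ->
     J (u n) @[n --> \oo] --> J x) ->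
  {for x, continuous J}.
Proof.
move=> cp seqJ; apply/cvgrPdist_lt => e e0; apply: contrapT => notJ.
have badP n : exists y, (forall k, (k <= n)%N -> `|p k x - p k y| < n.+1%:R^-1) /\
    ~ `|J x - J y| < e.
  apply: contrapT => /forallNP nbad; apply: notJ.
  have : \forall y \near x, forall k : 'I_n.+1, `|p k x - p k y| < n.+1%:R^-1.
    apply: filter_forall => k.
    by have /cvgrPdist_lt/(_ n.+1%:R^-1) := cp k x; apply; rewrite invr_gt0.
  apply: filterS => y py; apply: contrapT => Jy; apply: (nbad y); split=> // k kn.
  exact: (py (Ordinal (kn : (k < n.+1)%N))).
have [u uP] := choice badP.
have uJ : J (u n) @[n --> \oo] --> J x.
  apply: seqJ => k; apply/cvgrPdist_lt => d d0; near=> n.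
  have kn : (k <= n)%N by near: n; exact: nbhs_infty_ge.
  apply: lt_trans ((uP n).1 k kn) _; near: n.
  exact: (near_infty_natSinv_lt (PosNum d0)).
have /cvgrPdist_lt/(_ e e0)[N _ hN] := uJ.
by apply: (uP N).2; apply: hN => /=.
Unshelve. all: by end_near. Qed.

End sequential_continuity.

Section continuity_points.
Context (R : realType) (T : R).

(** Continuity at [t] of a nondecreasing function, as smallness of the mass of
    a neighbourhood of [t]. *)
Definition plan_continuity_point (C : plan T) (t : R) : Prop :=
  forall e : R, 0 < e -> exists2 d : R, 0 < d & C (t + d) - C (t - d) <= e.

Lemma plan_not_discontinuity (C : plan T) t :
  ~ discontinuity C t -> plan_continuity_point C t.
Proof.
move=> ndisc e e0.
have ndC := @plan_nondecreasing _ _ C.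
have rC : C x @[x --> t^'+] --> C t by exact: plan_right_continuous.
have lC : cvg (C x @[x --> t^'-]).
  apply: nondecreasing_at_left_is_cvgr.
    by apply: nearW => y a b _ _; exact: ndC.
  apply: nearW => y; exists (C t) => z [x /=]; rewrite in_itv/= => /andP[_ xt] <-.
  by apply: ndC; exact: ltW.
have {}lC : C x @[x --> t^'-] --> C t.
  have [<-//|ne] := eqVneq (lim (C x @[x --> t^'-])) (C t).
  exfalso; apply: ndisc; split => //; first by apply/cvg_ex; exists (C t).
  by rewrite (cvg_lim _ rC).
have e2 : 0 < e / 2 by rewrite divr_gt0.
have [x [xt Cx]] : exists x, x < t /\ C t - C x < e / 2.
  apply: (@filter_ex _ t^'-); near=> x; split.
    by near: x; exact: nbhs_left_lt.
  apply: le_lt_trans (ler_norm _) _; near: x.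
  by have /cvgrPdist_lt/(_ _ e2) := lC.
have [y [ty Cy]] : exists y, t < y /\ C y - C t < e / 2.
  apply: (@filter_ex _ t^'+); near=> y; split.
    by near: y; exact: nbhs_right_gt.
  apply: le_lt_trans (ler_norm _) _; rewrite distrC; near: y.
  by have /cvgrPdist_lt/(_ _ e2) := rC.
exists (Num.min (t - x) (y - t)); first by rewrite lt_min !subr_gt0 xt.
set d := Num.min _ _.
have h1 : C (t + d) <= C y by apply: ndC; rewrite -lerBrDl ge_min lexx orbT.
have h2 : C x <= C (t - d) by apply: ndC; rewrite lerBrDl -lerBrDr ge_min lexx.
lra.
Unshelve. all: by end_near. Qed.

Lemma ae_plan_continuity_point (C : plan T) :
  {ae (@lebesgue_measure R), forall t, t \in `]0, T[ -> plan_continuity_point C t}.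
Proof.
have ndC : {in `[0, T] &, nondecreasing_fun C}.
  by move=> x y _ _; exact: plan_nondecreasing.
have cD := discontinuity_countable ndC.
exists [set x | (x \in `]0, T[) /\ discontinuity C x]; split.
- by apply: countable_measurable cD.
- exact: countable_lebesgue_measure0.
- move=> t /= /not_implyP[tT nc]; split => //.
  by apply: contrapT => /plan_not_discontinuity.
Qed.

End continuity_points.

Lemma rational_bracket (R : realType) (T t d : R) : 0 < t < T -> 0 < d ->
  exists q q' p p' : rat,
    [/\ t - d < ratr q < (ratr q' : R), ratr q' < t, t < ratr p,
        (ratr p : R) < ratr p' < t + d &
        [/\ (ratr q : R) \in `[0, T], (ratr q' : R) \in `[0, T],
            (ratr p : R) \in `[0, T] & (ratr p' : R) \in `[0, T]]].
Proof.
move=> /andP[t0 tT] d0.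
have [p pP] : exists p : rat, ratr p \in `]t, Num.min T (t + d)[.
  by apply: rat_in_itvoo; rewrite lt_min tT ltrDl.
have [p' p'P] : exists p' : rat, ratr p' \in `](ratr p), (Num.min T (t + d))[.
  by apply: rat_in_itvoo; move: pP; rewrite in_itv/= => /andP[].
have [q' q'P] : exists q' : rat, ratr q' \in `](Num.max 0 (t - d)), t[.
  by apply: rat_in_itvoo; rewrite gt_max t0 gtrBl.
have [q qP] : exists q : rat, ratr q \in `](Num.max 0 (t - d)), (ratr q')[.
  by apply: rat_in_itvoo; move: q'P; rewrite in_itv/= => /andP[].
move: pP; rewrite in_itv/= lt_min => /and3P[tp pT pd].
move: p'P; rewrite in_itv/= lt_min => /and3P[pp' p'T p'd].
move: q'P; rewrite in_itv/= gt_max => /andP[/andP[q'0 q'd] q't].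
move: qP; rewrite in_itv/= gt_max => /andP[/andP[q0 qd] qq'].
exists q, q', p, p'; rewrite qd qq' pp' p'd !in_itv/= !ltW//.
- exact: lt_trans (lt_trans t0 tp) pp'.
- exact: lt_trans t0 tp.
- exact: lt_trans q't tT.
- exact: lt_trans qq' (lt_trans q't tT).
Qed.

Section satisfaction_convergence.
Context (R : realType) (T : R) (eta : R -> R) (theta : R -> R -> R).
Hypothesis theta_cont : {within `[0, T] `*` `[0, T],
  continuous (fun p : R * R => theta p.1 p.2)}.
Hypothesis theta_ge0 : forall t s, t \in `[0, T] -> s \in `[0, T] ->
  0 <= theta t s.
Notation Y := (@satisfaction R T eta theta).
Notation phi := (cutoff_kernel theta).

(** At a continuity point of the limit plan, cutoffs placed at rational times
    around [t] squeeze [Y (C n) t]. *)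
Lemma satisfaction_cvg (C : nat -> plan T) (C0 : plan T) t :
  plan_mass (C n) @[n --> \oo] --> plan_mass C0 ->
  (forall a b : rat, ratr a \in `[0, T] ->
     \int[dplan (C n)]_(s in `[0, T]) phi (ratr a) (ratr b) s @[n --> \oo] -->
     \int[dplan C0]_(s in `[0, T]) phi (ratr a) (ratr b) s) ->
  t \in `]0, T[ -> plan_continuity_point C0 t ->
  Y (C n) t @[n --> \oo] --> Y C0 t.
Proof.
move=> mC phiC tT' ct; have := tT'; rewrite in_itv/= => t0T.
have tT : t \in `[0, T] by case/andP: t0T => ? ?; rewrite in_itv/= !ltW.
have Yn C' := satisfactionE eta theta C' tT.
rewrite Yn; under eq_cvg do rewrite Yn.
apply: cvgD; first exact: cvg_cst.
apply/cvgrPdist_le => e e0.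
have [M M0 hM] := theta_bounded theta_cont.
set m := plan_mass C0; have m0 : 0 <= m by exact: plan_mass_ge0.
have k0 : 0 < 2 * m + M + 2 by rewrite ltr_wpDl// addr_ge0// mulr_ge0.
pose w := e / (2 * m + M + 2).
have w0 : 0 < w by rewrite divr_gt0.
have ew : e = w * (2 * m + M + 2) by rewrite /w divfK// gt_eqF.
have [d0 d0_gt0 hd0] := square_uniform_continuity theta_cont w0.
have [d1 d1_gt0 hd1] := ct w w0.
have d_gt0 : 0 < Num.min d0 d1 by rewrite lt_min d0_gt0.
have [q [q' [p [p' [qP q't tp pP [qT q'T pT p'T]]]]]] := rational_bracket t0T d_gt0.
move: qP => /andP[qd qq']; move: pP => /andP[pp' p'd].
set d := Num.min d0 d1 in d_gt0 qd p'd.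
have close x : x \in `[0, T] -> `|t - x| < d -> forall s, s \in `[0, T] ->
    `|theta t s - theta x s| <= w.
  move=> xT tx s sT; apply/ltW/hd0 => //; last by rewrite subrr normr0.
  by apply: lt_le_trans tx _; rewrite ge_min lexx.
have tp_d : `|t - ratr p| < d.
  by rewrite distrC gtr0_norm ?subr_gt0// ltrBlDl (lt_trans pp').
have tq_d : `|t - ratr q| < d.
  by rewrite gtr0_norm ?subr_gt0 ?(lt_trans qq')// ltrBlDl -ltrBlDr.
have dd1 : d <= d1 by rewrite ge_min lexx orbT.
have jump x y : t - d <= x -> y <= t + d -> C0 y - C0 x <= w.
  move=> tx yt; apply: le_trans hd1; apply: lerB; apply: plan_nondecreasing.
    by rewrite (le_trans yt)// lerD2l.
  by rewrite (le_trans _ tx)// lerB.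
pose I (C' : plan T) (h : R -> R) : R := \int[dplan C']_(s in `[0, T]) h s.
pose P : R -> R := theta t \_ (`[0, t]%classic : set R).
pose up := phi (ratr p) (ratr p').
pose lo := phi (ratr q) (ratr q').
have P_up C' : I C' P <= I C' up + w * plan_mass C'.
  exact: (past_le_late_cutoff theta_cont theta_ge0 pp' tT pT M0 (ltW w0) hM
    (close _ pT tp_d) C' (ltW tp)).
have up_P : I C0 up <= I C0 P + (w * m + M * (C0 (ratr p') - C0 t)).
  exact: (late_cutoff_le_past theta_cont theta_ge0 pp' tT pT p'T M0 (ltW w0) hM
    (close _ pT tp_d) C0 (ltW tp)).
have lo_P C' : I C' lo <= I C' P + w * plan_mass C'.
  exact: (early_cutoff_le_past theta_cont theta_ge0 qq' tT qT M0 (ltW w0) hM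
    (close _ qT tq_d) C' (ltW q't)).
have P_lo : I C0 P <= I C0 lo + (w * m + M * (C0 t - C0 (ratr q))).
  exact: (past_le_early_cutoff theta_cont theta_ge0 qq' tT qT M0 (ltW w0) hM
    (close _ qT tq_d) C0 (ltW q't)).
have jp : M * (C0 (ratr p') - C0 t) <= M * w.
  by apply: ler_wpM2l => //; apply: jump; [rewrite gerBl ltW|exact: ltW].
have jq : M * (C0 t - C0 (ratr q)) <= M * w.
  by apply: ler_wpM2l => //; apply: jump; [exact: ltW|rewrite lerDl ltW].
near=> n.
have mn : w * plan_mass (C n) <= w * (m + 1).
  rewrite ler_wpM2l ?(ltW w0)//; have : `|m - plan_mass (C n)| <= 1.
    by near: n; have /cvgrPdist_le := mC; apply.
  by rewrite ler_distlC => /andP[].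
have upn : `|I C0 up - I (C n) up| <= w.
  by near: n; have /cvgrPdist_le := phiC p p' pT; apply.
have lon : `|I C0 lo - I (C n) lo| <= w.
  by near: n; have /cvgrPdist_le := phiC q q' qT; apply.
change (`|I C0 P - I (C n) P| <= e).
have Pn := P_up (C n); have nP := lo_P (C n).
move: upn lon mn up_P P_lo jp jq Pn nP; rewrite ew !ler_norml.
move: (I C0 P) (I (C n) P) (I C0 up) (I (C n) up) (I C0 lo) (I (C n) lo).
move: (M * (_ - C0 t)) (M * (C0 t - _)) (w * plan_mass (C n)); clear.
move=> j1 j2 wn P0 Pn u0 un l0 ln /andP[? ?] /andP[? ?] ? ? ? ? ? ? ?.
by apply/andP; split; lra.
Unshelve. all: by end_near. Qed.

End satisfaction_convergence.

(** * The aggregator *)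

Section aggregator.
Context (R : realType).
Implicit Types (h : R -> R -> R).

(** Near [y] the increment of [h] in its first argument is the partial
    derivative times [y' - y] up to an error smaller than [`|y' - y|]. *)
Lemma C1_halfplane_local_lipschitz h (y u : R) : C1_halfplane h -> 0 <= y ->
  exists L : R, 0 <= L /\
    \forall y' \near y, 0 <= y' -> `|h y' u - h y u| <= L * `|y' - y|.
Proof.
move=> [g [_ hg]] y0.
pose p : R * R := (y, u).
exists (1 + `|(g p).1|); split; first by rewrite addr_ge0.
have /cvgrPdist_lt/(_ 1 ltr01) := hg p y0.
move=> hp; have {hp} : nbhs p (fun q : R * R => q != p -> 0 <= q.1 ->
  `|0 - (h q.1 q.2 - h p.1 p.2 - ((g p).1 * (q.1 - p.1) + (g p).2 * (q.2 - p.2)))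
     / `|q - p| | < 1) by exact: hp.
move=> /nbhs_ballP[r /= r0 hr].
apply/nbhs_ballP; exists r => //= y' yy' y'0.
have [->|ne] := eqVneq y' y; first by rewrite !subrr normr0 mulr0.
have nE : `|(y', u) - p| = `|y' - y|.
  by rewrite prod_normE/= subrr normr0; apply/max_idPl.
have y'y : 0 < `|y' - y| by rewrite normr_gt0 subr_eq0.
have pball : ball p r (y', u) by split => //=; exact: ballxx.
have pne : (y', u) != p by apply: contra ne => /eqP[->].
have := hr (y', u) pball pne y'0.
rewrite /= subrr mulr0 addr0 sub0r normrN nE normrM normfV normr_id.
rewrite ltr_pdivrMr// mul1r => lt1.
rewrite mulrDl mul1r -normrM.
rewrite -{1}(subrK ((g p).1 * (y' - y)) (h y' u - h y u)).
by rewrite (le_trans (ler_normD _ _))// lerD// ltW.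
Qed.

Lemma C1_halfplane_within_continuous h (y u : R) : C1_halfplane h -> 0 <= y ->
  h y' u @[y' --> within [set z | 0 <= z] (nbhs y)] --> h y u.
Proof.
move=> hC1 y0; have [L [L0 hL]] := C1_halfplane_local_lipschitz u hC1 y0.
apply/cvgrPdist_lt => e e0.
have L1 : 0 < L + 1 by rewrite ltr_wpDl.
rewrite near_withinE; near=> y' => y'0.
rewrite distrC; apply: le_lt_trans (_ : (L + 1) * `|y - y'| < e).
  have y'L : 0 <= y' -> `|h y' u - h y u| <= L * `|y' - y| by near: y'.
  by rewrite [`|y - y'|]distrC (le_trans (y'L y'0))// ler_wpM2r// lerDl.
rewrite mulrC -ltr_pdivlMr//; near: y'.
have /cvgrPdist_lt := @cvg_id _ (nbhs y); apply.
by rewrite divr_gt0.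
Unshelve. all: by end_near. Qed.

Lemma strictly_concave_halfplane_le h (y u y' u' l : R) :
  strictly_concave_halfplane h -> 0 <= y -> 0 <= y' -> 0 <= l <= 1 ->
  l * h y u + (1 - l) * h y' u' <=
  h (l * y + (1 - l) * y') (l * u + (1 - l) * u').
Proof.
move=> hc y0 y'0 /andP[l0 l1].
have [->|l_neq0] := eqVneq l 0; first by rewrite !mul0r !add0r subr0 !mul1r.
have [->|l_neq1] := eqVneq l 1; first by rewrite subrr !mul0r !addr0 !mul1r.
have [[-> ->]|ne] := eqVneq (y, u) (y', u').
  by rewrite -!mulrDl addrC subrK !mul1r.
by apply/ltW/hc => //; rewrite !lt_neqAle l0 l1 eq_sym l_neq0 l_neq1.
Qed.

Lemma aggregator_field (T K K' alpha B : R) (f : R -> R -> R -> R) (Y : R -> R) :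
  aggregator_measurable T f -> assumption_a1 T f ->
  (forall s y u u', s \in `[0, T] -> 0 <= y ->
     `|f s y u - f s y u'| <= K * `|u - u'|) ->
  0 <= alpha -> 0 <= K' ->
  (forall s y, s \in `[0, T] -> 0 <= y -> `|f s y 0| <= K' * (1 + `|y| `^ alpha)) ->
  measurable_fun `[0, T] Y -> (forall s, s \in `[0, T] -> 0 <= Y s <= B) ->
  lipschitz_field T K (K' * (1 + B `^ alpha)) (fun s u => f s (Y s) u).
Proof.
move=> mf a1 fK al0 K'0 fK' mY Y0B; split.
- move=> u.
  have m : measurable_fun `[0, T] (fun s => f s (Num.max (Y s) 0) u).
    (* [f] is controlled for nonnegative levels only, hence the positive part. *)
    apply: (@measurable_fun_caratheodory _ _ _ _
      (fun s y => f s (Num.max y 0) u)) => //.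
      by move=> y; apply: mf; rewrite le_max lexx orbT.
    move=> s /= sT; have /andP[Ys0 _] := Y0B s sT.
    have [_ fC1 _] := a1 s sT; rewrite (max_idPl Ys0).
    have := @C1_halfplane_within_continuous (f s) (Y s) u fC1 Ys0.
    move=> /cvgrPdist_lt cf; apply/cvgrPdist_lt => e e0.
    have := cf e e0; rewrite !near_withinE; apply: filterS => y hy Ysy.
    have y0 : 0 <= y by rewrite (le_trans Ys0)// ltW.
    by rewrite (max_idPl y0); exact: hy.
  apply: eq_measurable_fun m => s; rewrite inE/= => sT.
  by have /andP[Ys0 _] := Y0B s sT; rewrite (max_idPl Ys0).
- by move=> s u v sT; apply: fK => //; have /andP[] := Y0B s sT.
- move=> s sT; have /andP[Ys0 YsB] := Y0B s sT.
  apply: le_trans (fK' s _ sT Ys0) _; rewrite ler_wpM2l// lerD2l ger0_norm//.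
  by rewrite ge0_ler_powR// ?nnegrE// (le_trans Ys0).
Unshelve. all: by end_near. Qed.

End aggregator.

(** * The utility functional *)

Section utility.
Context (R : realType) (T : R) (eta : R -> R) (theta : R -> R -> R).
Context (f : R -> R -> R -> R) (K K' alpha : R).
Notation mu := (@lebesgue_measure R).
Hypothesis T_gt0 : 0 < T.
Hypothesis eta_cont : {within `[0, T], continuous eta}.
Hypothesis eta_ge0 : forall t, t \in `[0, T] -> 0 <= eta t.
Hypothesis theta_cont : {within `[0, T] `*` `[0, T],
  continuous (fun p : R * R => theta p.1 p.2)}.
Hypothesis theta_ge0 : forall t s, t \in `[0, T] -> s \in `[0, T] ->
  0 <= theta t s.
Hypothesis f_meas : aggregator_measurable T f.
Hypothesis f_a1 : assumption_a1 T f.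
Hypothesis K_gt0 : 0 < K.
Hypothesis f_lip : forall s y u u', s \in `[0, T] -> 0 <= y ->
  `|f s y u - f s y u'| <= K * `|u - u'|.
Hypothesis alpha_ge0 : 0 <= alpha.
Hypothesis K'_ge0 : 0 <= K'.
Hypothesis f_growth : forall s y, s \in `[0, T] -> 0 <= y ->
  `|f s y 0| <= K' * (1 + `|y| `^ alpha).

Notation Y := (@satisfaction R T eta theta).
Notation U := (@utility_process R T eta theta f).
Notation F C := (fun s u => f s (Y C s) u).
Implicit Types (C D : plan T).

(** Uniformity in the plan provides a single dominating constant along a weakly
    convergent sequence, whose masses are bounded. *)
Lemma plan_field (m : R) : exists M : R, forall C, plan_mass C <= m ->
  lipschitz_field T K M (F C).
Proof.
have [MY [MY0 hMY]] := satisfaction_le eta_cont theta_cont.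
exists (K' * (1 + (MY * (1 + m)) `^ alpha)) => C Cm.
apply: aggregator_field => //.
  exact: satisfaction_measurable.
move=> s sT; rewrite satisfaction_ge0//=.
by rewrite (le_trans (hMY C s sT))// ler_wpM2l// lerD2l.
Qed.

Lemma utility_solves C : solves T (F C) (U C).
Proof.
have [M FL] := plan_field (plan_mass C).
have [V FV] := solves_exists (ltW T_gt0) K_gt0 (FL C (lexx _)).
by apply: (@xgetPex _ _ [set V | solution T f (Y C) V]); exists V.
Qed.

Lemma utility_unique C V : solves T (F C) V -> {in `[0, T], V =1 U C}.
Proof.
have [M FL] := plan_field (plan_mass C).
by move=> FV; apply: (solves_unique K_gt0 (FL C (lexx _)) (utility_solves C)).
Qed.

Lemma utility_stability C D s : s \in `[0, T] ->
  `|U C s - U D s| <= \int[mu]_(t in `[s, T])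
    (expR (2 * K * t) * `|f t (Y C t) (U C t) - f t (Y D t) (U C t)|).
Proof.
have [M FL] := plan_field (Num.max (plan_mass C) (plan_mass D)).
apply: (solves_stability K_gt0 (FL C _) (FL D _)).
- by rewrite le_max lexx.
- by rewrite le_max lexx orbT.
- exact: utility_solves.
- exact: utility_solves.
Qed.

(** By stability it suffices that the integrands for [C n] and [C0], both
    evaluated at the utility of [C0], become close; they do so at almost every
    time and are uniformly bounded. *)
Lemma utility_cvg (C : nat -> plan T) (C0 : plan T) :
  plan_mass (C n) @[n --> \oo] --> plan_mass C0 ->
  (forall a b : rat, ratr a \in `[0, T] ->
     \int[dplan (C n)]_(s in `[0, T]) cutoff_kernel theta (ratr a) (ratr b) s
       @[n --> \oo] -->
     \int[dplan C0]_(s in `[0, T]) cutoff_kernel theta (ratr a) (ratr b) s) ->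
  U (C n) 0 @[n --> \oo] --> U C0 0.
Proof.
move=> mC phiC.
have [m [C0m Cm]] : exists m : R, plan_mass C0 <= m /\ forall n, plan_mass (C n) <= m.
  have [B [_ hB]] := cvg_seq_bounded (cvgP _ mC).
  exists (Num.max (plan_mass C0) (B + 1)); split; first by rewrite le_max lexx.
  move=> n; rewrite le_max; apply/orP; right; apply: le_trans (ler_norm _) _.
  by apply: hB => //; rewrite ltrDl.
have [M FL] := plan_field m.
have FL0 := FL C0 C0m.
have U0 := utility_solves C0.
have [B [U0B _]] := solves_bounded (ltW K_gt0) FL0 U0.
have mU0 := solves_measurable (ltW K_gt0) FL0 U0.
pose g n (t : R) : R := `|f t (Y C0 t) (U C0 t) - f t (Y (C n) t) (U C0 t)|.
pose e (t : R) : R := expR (2 * K * t).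
have mF D : plan_mass D <= m ->
    measurable_fun `[0, T] (fun t => f t (Y D t) (U C0 t)).
  by move=> Dm; exact: lipschitz_field_measurable (FL D Dm) mU0.
have bF D t : plan_mass D <= m -> t \in `[0, T] ->
    `|f t (Y D t) (U C0 t)| <= M + K * B.
  move=> Dm tT; apply: le_trans (lipschitz_field_bound _ (FL D Dm) tT) _.
  by rewrite lerD2l ler_wpM2l ?(ltW K_gt0)// U0B.
have me : measurable_fun `[0, T] e.
  apply: subspace_continuous_measurable_fun => //; apply: continuous_subspaceT => t.
  apply: continuous_comp; last exact: continuous_expR.
  by apply: cvgM; [exact: cvg_cst|exact: cvg_id].
pose N : R := expR (2 * K * T) * (2 * (M + K * B)).
have gN n t : t \in `[0, T] -> `|e t * g n t| <= N.
  move=> tT; rewrite normrM normr_id ger0_norm ?expR_ge0//.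
  apply: ler_pM; rewrite ?expR_ge0//.
    rewrite ler_expR ler_wpM2l ?mulr_ge0 ?(ltW K_gt0)//.
    by move: tT; rewrite in_itv/= => /andP[].
  by rewrite (le_trans (ler_normB _ _))// mulr_natl mulr2n lerD// bF.
have mg n : measurable_fun `[0, T] (fun t => e t * g n t).
  apply: measurable_funM => //; apply: measurableT_comp => //.
  by apply: measurable_funB; apply: mF.
have gcvg : {ae mu, forall t, t \in `[0, T] ->
    e t * g n t @[n --> \oo] --> 0}.
  have FF : Filter (almost_everywhere mu) by exact: ae_filter_ringOfSetsType.
  have := ae_itvoo_itvcc (ae_plan_continuity_point C0).
  apply: filterS => t cpt /[dup] tT /cpt[tT0 {}cpt].
  have Yt := satisfaction_cvg theta_cont theta_ge0 mC phiC tT0 cpt.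
  have Y0 := satisfaction_ge0 eta_ge0 theta_ge0 _ tT.
  have [_ fC1 _] := f_a1 tT.
  have fc := @C1_halfplane_within_continuous _ (f t) (Y C0 t) (U C0 t) fC1 (Y0 C0).
  have fY : f t (Y (C n) t) (U C0 t) @[n --> \oo] --> f t (Y C0 t) (U C0 t).
    apply/cvgrPdist_lt => d d0; have /cvgrPdist_lt/(_ d d0) := fc.
    rewrite near_withinE => hd.
    have {}hd : \forall n \near \oo, 0 <= Y (C n) t ->
      `|f t (Y C0 t) (U C0 t) - f t (Y (C n) t) (U C0 t)| < d := Yt eta _ hd.
    by apply: filterS hd => n; apply; exact: Y0.
  rewrite -(mulr0 (e t)) -(normr0 R) -(subrr (f t (Y C0 t) (U C0 t))).
  apply: cvgM; first exact: cvg_cst.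
  apply: cvg_norm; apply: (cvgB _ fY); exact: cvg_cst.
have cvg0 := Rintegral_itvcc_cvg0 mg gN gcvg.
apply/cvgrPdist_le => d d0.
have /cvgrPdist_le/(_ d d0) := cvg0; apply: filterS => n.
rewrite sub0r normrN => /(le_trans _); apply.
apply: le_trans (utility_stability C0 (C n) _) (ler_norm _).
by rewrite in_itv/= lexx ltW.
Qed.

(** The total mass and the cutoff kernels at rational times form a countable
    family of test functions that controls the utility. *)
Lemma utility_continuous : continuous (fun C : plan T => U C 0).
Proof.
move=> C0.
pose phi (k : nat) : R -> R :=
  if unpickle k is Some (a, b) then
    if (ratr a : R) \in `[0, T] then cutoff_kernel theta (ratr a) (ratr (b : rat))
    else cst 1
  else cst 1.
have cst1 : {within `[0, T], continuous (cst 1 : R -> R)}.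
  by apply: continuous_subspaceT => x; exact: cvg_cst.
have cphi k : {within `[0, T], continuous (phi k)}.
  rewrite /phi; case: unpickle => // -[a b]; case: ifPn => // aT.
  exact: cutoff_kernel_continuous.
pose I (h : R -> R) (C : plan T) : R := \int[dplan C]_(s in `[0, T]) h s.
(* Index 0 is the total mass. *)
pose p (k : nat) : plan T -> R := if k is k'.+1 then I (phi k') else I (cst 1).
have cp k : continuous (p k).
  by case: k => [|k]; apply: test_integral_continuous.
apply: (countable_test_continuous cp) => C pC.
have mass D : I (cst 1) D = plan_mass D.
  by rewrite /I Rintegral_cst ?mul1r//; exact: measurable_itv.
apply: utility_cvg.
  by have := pC 0%N; rewrite /= mass; under eq_cvg do rewrite mass.
move=> a b aT; have := pC (pickle (a, b)).+1.
by rewrite /= /I /phi pickleK aT.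
Qed.

Local Open Scope convex_scope.

(** The mixture [Z] of the utility processes is a subsolution of the equation
    for the mixed plan, because the satisfaction level is affine in the plan
    and [f t] is jointly concave. *)
Lemma utility_mix_comparison (l : {i01 R}) C D :
  let Z s := l%:num * U C s + (1 - l%:num) * U D s in
  let z s := l%:num * f s (Y C s) (U C s) + (1 - l%:num) * f s (Y D s) (U D s) in
  Z 0 <= U (C <| l |> D) 0 /\
  forall x y, 0 <= x -> x < y -> y <= T ->
    (forall s, s \in `]x, y[ -> z s < f s (Y (C <| l |> D) s) (Z s)) ->
    Z 0 < U (C <| l |> D) 0.
Proof.
move=> Z z; pose E : plan T := C <| l |> D.
have [M FL] := plan_field
  (Num.max (plan_mass E) (Num.max (plan_mass C) (plan_mass D))).
have FLE : lipschitz_field T K M (F E) by apply: FL; rewrite le_max lexx.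
have FLC : lipschitz_field T K M (F C) by apply: FL; rewrite !le_max lexx orbT.
have FLD : lipschitz_field T K M (F D) by apply: FL; rewrite !le_max lexx !orbT.
have [UC UD] := (utility_solves C, utility_solves D).
have [BC [_ FBC]] := solves_bounded (ltW K_gt0) FLC UC.
have [BD [_ FBD]] := solves_bounded (ltW K_gt0) FLD UD.
have l0 : 0 <= l%:num :> R by [].
have l1 : 0 <= 1 - l%:num :> R by rewrite subr_ge0.
have mFC : measurable_fun `[0, T] (fun s => f s (Y C s) (U C s)).
  apply: (lipschitz_field_measurable FLC).
  exact: solves_measurable (ltW K_gt0) FLC UC.
have mFD : measurable_fun `[0, T] (fun s => f s (Y D s) (U D s)).
  apply: (lipschitz_field_measurable FLD).
  exact: solves_measurable (ltW K_gt0) FLD UD.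
have mz : measurable_fun `[0, T] z.
  exact: measurable_affine mFC mFD.
have zB s : s \in `[0, T] -> `|z s| <= l%:num * BC + (1 - l%:num) * BD.
  by move=> sT; exact: normr_affine_le l0 l1 (FBC s sT) (FBD s sT).
have Zz t : t \in `[0, T] -> Z t = \int[mu]_(s in `[t, T]) z s.
  move=> /[dup] tT; rewrite in_itv/= => /andP[t0 _].
  have FCi : mu.-integrable `[t, T] (EFin \o (fun s => f s (Y C s) (U C s))).
    exact: integrable_itvccS UC.1.
  have FDi : mu.-integrable `[t, T] (EFin \o (fun s => f s (Y D s) (U D s))).
    exact: integrable_itvccS UD.1.
  rewrite /Z (UC.2 t tT) (UD.2 t tT); apply/esym.
  exact: (Rintegral_affine _ _ _ FCi FDi).
have zF s : s \in `[0, T] -> z s <= f s (Y E s) (Z s).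
  move=> sT; rewrite /E satisfaction_conv//; have [fc _ _] := f_a1 sT.
  have l01 : (0 : R) <= l%:num <= 1 by rewrite l0 -subr_ge0.
  have Y0 (G : plan T) : 0 <= Y G s by exact: satisfaction_ge0.
  exact: (@strictly_concave_halfplane_le _ (f s) (Y C s) (U C s) (Y D s) (U D s)
    l%:num fc (Y0 C) (Y0 D) l01).
have [cmp cmp_lt] := solves_comparison (ltW T_gt0) K_gt0 FLE (utility_solves E)
  mz zB Zz zF.
by split => //; apply: cmp; rewrite in_itv/= lexx ltW.
Qed.

(** By right continuity the two levels stay apart on an interval, so that the
    set of times at which the concavity of [f] is strict has positive measure. *)
Lemma satisfaction_neq_right C D t : t \in `[0, T[ -> Y C t != Y D t ->
  exists2 y, t < y <= T & forall s, s \in `]t, y[ -> Y C s != Y D s.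
Proof.
rewrite in_itv/= => /andP[t0 tltT] ne.
have tT : t \in `[0, T] by rewrite in_itv/= t0 ltW.
have e0 : 0 < `|Y C t - Y D t| by rewrite normr_gt0 subr_eq0.
have absurd_dist (x y : R) : ~~ (`|x - (y - y)| < `|x|).
  by rewrite subrr subr0 ltxx.
have cCD : Y C (Num.min s T) - Y D (Num.min s T) @[s --> t^'+] --> Y C t - Y D t.
  by apply: cvgB; exact: satisfaction_right_continuous.
have /cvgrPdist_lt/(_ _ e0) near_ne := cCD.
have {}near_ne : \forall s \near t,
    t < s -> Y C (Num.min s T) != Y D (Num.min s T).
  move: near_ne; rewrite near_withinE; apply: filterS => s h ts.
  have := h ts; apply: contraTneq => /= ->.
  exact: absurd_dist.
have [d /= d0 hd] := near_ne.
exists (Num.min T (t + d)); first by rewrite lt_min tltT ltrDl d0 ge_min lexx.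
move=> s; rewrite in_itv/= lt_min => /and3P[ts sT sd].
rewrite -[s](min_idPl (ltW sT)); apply: hd => //=.
by rewrite distrC gtr0_norm ?subr_gt0// ltrBlDl.
Qed.

Lemma utility_strictly_concave :
  strictly_concave_plan Y (fun C => U C 0).
Proof.
split=> [l C D|l C D l01 [t tT Yne]].
  exact: (utility_mix_comparison l C D).1.
have t0 : 0 <= t by move: tT; rewrite in_itv/= => /andP[].
have [y /andP[ty yT] hne] := satisfaction_neq_right tT Yne.
apply: ((utility_mix_comparison l C D).2 t y t0 ty yT) => s sty.
have sT : s \in `[0, T].
  move: sty; rewrite !in_itv/= => /andP[ts sy].
  by rewrite (le_trans t0 (ltW ts)) (le_trans (ltW sy) yT).
rewrite satisfaction_conv//; have [fc _ _] := f_a1 sT.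
have Y0 (G : plan T) : 0 <= Y G s by exact: satisfaction_ge0.
apply: (fc (Y C s) (U C s) (Y D s) (U D s) l%:num (Y0 C) (Y0 D) _ l01).
by rewrite xpair_eqE negb_and (hne s sty).
Qed.

End utility.

Theorem proposition2p2 (R : realType) (T w : R) (T_gt0 : 0 < T) (w_gt0 : 0 < w)
    (psi : R -> R) (psi_cont : {within `[0, T], continuous psi})
    (psi_gt0 : forall t, t \in `[0, T] -> 0 < psi t)
    (eta : R -> R) (eta_cont : {within `[0, T], continuous eta})
    (eta_ge0 : forall t, t \in `[0, T] -> 0 <= eta t)
    (theta : R -> R -> R)
    (theta_cont : {within `[0, T] `*` `[0, T],
                     continuous (fun p : R * R => theta p.1 p.2)})
    (theta_ge0 : forall t s, t \in `[0, T] -> s \in `[0, T] -> 0 <= theta t s)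
    (f : R -> R -> R -> R) (f_meas : aggregator_measurable T f)
    (f_a1 : assumption_a1 T f) (f_a2 : assumption_a2 T f)
    (f_a3 : assumption_a3 T f) :
  let A := budget_set psi w : set (plan T) in
  let Y := satisfaction eta theta : plan T -> R -> R in
  let U := utility_process eta theta f : plan T -> R -> R in
  (forall C, A C ->
     solution T f (Y C) (U C) /\
     forall V, solution T f (Y C) V -> {in `[0, T], V =1 U C}) /\
  (exists2 K : R, 0 < K &
     forall C C', A C -> A C' -> forall s, s \in `[0, T] ->
       `|U C s - U C' s|
         <= \int[lebesgue_measure]_(t in `[s, T])
              (expR (K * t) * `|f t (Y C t) (U C t) - f t (Y C' t) (U C t)|)) /\
  continuous (fun C : plan T => U C 0) /\
  strictly_concave_plan Y (fun C => U C 0).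
Proof.
move=> A Y U; have [K [K0 fK]] := f_a2.
have [alpha [K' [/andP[al0 _] K'0 fK']]] := f_a3.
have solves_U := utility_solves T_gt0 eta_cont eta_ge0 theta_cont theta_ge0
  f_meas f_a1 K0 fK (ltW al0) (ltW K'0) fK'.
split=> [C _|]; first split; first exact: solves_U.
  move=> V; exact: (utility_unique T_gt0 eta_cont eta_ge0 theta_cont theta_ge0
    f_meas f_a1 K0 fK (ltW al0) (ltW K'0) fK').
split; first exists (2 * K); first by rewrite mulr_gt0.
  move=> C C' _ _ s; exact: (utility_stability T_gt0 eta_cont eta_ge0 theta_cont
    theta_ge0 f_meas f_a1 K0 fK (ltW al0) (ltW K'0) fK').
split.
  exact: (utility_continuous T_gt0 eta_cont eta_ge0 theta_cont theta_ge0
    f_meas f_a1 K0 fK (ltW al0) (ltW K'0) fK').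
exact: (utility_strictly_concave T_gt0 eta_cont eta_ge0 theta_cont theta_ge0
  f_meas f_a1 K0 fK (ltW al0) (ltW K'0) fK').
Qed.
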